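(* Let $\mathcal{I}$ be a reflexive prime difference ideal in $\mathcal{F}\{y_1,\ldots,y_n\}$ of dimension $d>0$ and order $h$. Let $\mathbb{P}$ be a generic difference polynomial of order $s$ (and some degree $r>0$) with coefficient set $\mathbf{u}$. Then the difference ideal $[\mathcal{I},\mathbb{P}]$ generated by $\mathcal{I}$ and $\mathbb{P}$ in $\mathcal{F}\langle\mathbf{u}\rangle\{y_1,\ldots,y_n\}$ is a reflexive prime difference ideal of dimension $d-1$ and order $h+s$.
   Context: A difference field is a field $\mathcal{F}$ with an operation $\sigma$ such that $\sigma(a+b)=\sigma(a)+\sigma(b)$, $\sigma(ab)=\sigma(a)\sigma(b)$, and $\sigma(a)=0$ iff $a=0$. Write $a^{(k)}=\sigma^k(a)$. Throughout, $\mathcal{F}$ is a difference field. $\mathcal{F}\langle S\rangle$ denotes the smallest difference subfield (of a given difference overfield) containing $\mathcal{F}$ and $S$. A family is transformally independent over $\mathcal{F}$ (a family of difference indeterminates) if the family of all transforms $\sigma^k$ ($k\ge 0$) of its elements is algebraically independent over $\mathcal{F}$; the transformal transcendence degree is the cardinality of a maximal transformally independent subset. $\mathcal{F}\{y_1,\ldots,y_n\}=\mathcal{F}[y_j^{(k)}:1\le j\le n,\ k\ge0]$ is the difference polynomial ring in difference indeterminates $y_1,\ldots,y_n$. A difference ideal is an ideal closed under $\sigma$; $[S]$ is the difference ideal generated by $S$. A difference ideal $\mathcal{I}$ is reflexive if $a^{(1)}\in\mathcal{I}$ implies $a\in\mathcal{I}$; prime difference ideals are assumed not to be the unit ideal.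 Every reflexive prime difference ideal $\mathcal{I}$ has a generic zero $\eta=(\eta_1,\ldots,\eta_n)$ in a difference overfield: $P(\eta)=0$ iff $P\in\mathcal{I}$. The dimension $\dim(\mathcal I)$ is the transformal transcendence degree of $\mathcal{F}\langle\eta\rangle$ over $\mathcal{F}$. If $\dim(\mathcal I)=d$, there is an integer $h\ge0$ with $\mathrm{tr.deg}\,\mathcal{F}(\eta_i^{(k)}:1\le i\le n,\ 0\le k\le t)/\mathcal{F}=d(t+1)+h$ for all sufficiently large $t$; $h$ is the order $\mathrm{ord}(\mathcal{I})$. Let $\mathfrak{m}_{s,r}$ be the set of all difference monomials in $\mathcal{F}\{y_1,\ldots,y_n\}$ of order $\le s$ and degree $\le r$ ($r>0$), and let $\{u_m\}_{m\in\mathfrak{m}_{s,r}}$ be a set of difference indeterminates over $\mathcal{F}$ (also independent of the $y$'s). Then $\sum_{m\in\mathfrak{m}_{s,r}}u_m m$ is a generic difference polynomial of order $s$ and degree $r$, with coefficient set $\{u_m\}$. *)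

(* Defs.v *)
From HB Require Import structures.
From mathcomp Require Import all_boot all_order all_algebra finmap.
From mathcomp.multinomials Require Import monalg.

Set Implicit Arguments.
Unset Strict Implicit.
Unset Printing Implicit Defensive.

Import GRing.Theory.
Local Open Scope ring_scope.

(* For maps between fields, "additive, multiplicative and vanishing only at 0"
   is the same as being a (unital) ring morphism. *)
Record diffField := DiffField {
  dfield :> fieldType;
  shift : {rmorphism dfield -> dfield}
}.

Record diffExt (F : diffField) := DiffExt {
  ext_field :> diffField;
  emb : {rmorphism F -> ext_field};
  emb_shift : forall a : F, emb (shift F a) = shift ext_field (emb a)
}.

Definition transform (F : diffField) (k : nat) (a : F) : F :=
  iter k (shift F) a.

(* Polynomials over R in the (possibly infinitely many) variables indexed by I
   are {malg R[{cmonom I}]}; pvar i is the variable i and peval f v p is the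
   value of p after applying f to its coefficients and sending i to v i. *)
Definition pvar (R : comNzRingType) (I : choiceType) (i : I) :
  {malg R[{cmonom I}]} := << ucm i >>.

Definition peval (R S : comNzRingType) (I : choiceType)
    (f : R -> S) (v : I -> S) (p : {malg R[{cmonom I}]}) : S :=
  mmap f (fun m : {cmonom I} => \prod_(i <- finsupp (cmonom_val m)) v i ^+ m i) p.

Section Extension.
Context (F : diffField) (L : diffExt F).

Definition alg_indep (I : choiceType) (b : I -> L) : Prop :=
  forall p : {malg F[{cmonom I}]}, peval (emb L) b p = 0 -> p = 0.

Definition transf_indep (I : choiceType) (b : I -> L) : Prop :=
  alg_indep (fun v : I * nat => transform v.2 (b v.1)).

Definition is_subfield (S : L -> Prop) : Prop :=
  [/\ forall a : F, S (emb L a),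
      forall x y, S x -> S y -> S (x - y),
      forall x y, S x -> S y -> S (x * y) &
      forall x, S x -> S x^-1].

Definition is_diff_subfield (S : L -> Prop) : Prop :=
  is_subfield S /\ forall x, S x -> S (shift L x).

(* F(X) and F<X> inside L. *)
Definition gen_field (X : L -> Prop) (z : L) : Prop :=
  forall S : L -> Prop, is_subfield S -> (forall x, X x -> S x) -> S z.

Definition gen_diff_field (X : L -> Prop) (z : L) : Prop :=
  forall S : L -> Prop, is_diff_subfield S -> (forall x, X x -> S x) -> S z.

Definition extend_family (e : nat) (b : 'I_e -> L) (x : L)
    (o : option 'I_e) : L :=
  if o is Some i then b i else x.

(* e is the cardinality of a maximal independent subset of E; independent
   families are injective, so families indexed by 'I_e count correctly. *)
Definition has_trdeg (E : L -> Prop) (e : nat) : Prop :=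
  exists b : 'I_e -> L,
    [/\ forall i, E (b i), alg_indep b &
        forall x, E x -> ~ alg_indep (extend_family b x)].

Definition has_transf_trdeg (E : L -> Prop) (e : nat) : Prop :=
  exists b : 'I_e -> L,
    [/\ forall i, E (b i), transf_indep b &
        forall x, E x -> ~ transf_indep (extend_family b x)].

End Extension.

(* F{y_1, ..., y_n}; the variable (j, k) is y_j^(k). *)
Notation "{ 'dpoly' F [ n ] }" := {malg F[{cmonom ('I_n * nat)%type}]}
  (at level 0, F, n at level 2, format "{ 'dpoly'  F [ n ] }") : type_scope.

Section DiffPoly.
Context (F : diffField) (n : nat).

Definition ptransform (p : {dpoly F[n]}) : {dpoly F[n]} :=
  peval (malgC \o shift F) (fun v => pvar F (v.1, v.2.+1)) p.

Definition deval (L : diffExt F) (eta : 'I_n -> L) (p : {dpoly F[n]}) : L :=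
  peval (emb L) (fun v => transform v.2 (eta v.1)) p.

Definition dmap (L : diffExt F) (p : {dpoly F[n]}) : {dpoly L[n]} :=
  peval (malgC \o emb L) (fun v => pvar L v) p.

Definition is_diff_ideal (J : {dpoly F[n]} -> Prop) : Prop :=
  [/\ J 0,
      forall p q, J p -> J q -> J (p + q),
      forall p q, J q -> J (p * q) &
      forall p, J p -> J (ptransform p)].

Definition gen_diff_ideal (X : {dpoly F[n]} -> Prop) (p : {dpoly F[n]}) : Prop :=
  forall J, is_diff_ideal J -> (forall q, X q -> J q) -> J p.

Definition is_reflexive_prime_diff_ideal (J : {dpoly F[n]} -> Prop) : Prop :=
  [/\ is_diff_ideal J,
      forall p, J (ptransform p) -> J p,
      ~ J 1 &
      forall p q, J (p * q) -> J p \/ J q].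

Definition is_generic_zero (J : {dpoly F[n]} -> Prop)
    (L : diffExt F) (eta : 'I_n -> L) : Prop :=
  forall p, deval eta p = 0 <-> J p.

Definition has_dim (J : {dpoly F[n]} -> Prop) (d : nat) : Prop :=
  exists (L : diffExt F) (eta : 'I_n -> L),
    is_generic_zero J eta /\
    has_transf_trdeg (gen_diff_field (fun x => exists i, x = eta i)) d.

(* F(eta_i^(k) : i, k <= t) *)
Definition trunc_field (L : diffExt F) (eta : 'I_n -> L) (t : nat) : L -> Prop :=
  gen_field (fun x => exists i k, (k <= t)%N /\ x = transform k (eta i)).

Definition has_ord (J : {dpoly F[n]} -> Prop) (h : nat) : Prop :=
  exists d : nat, has_dim J d /\
  exists (L : diffExt F) (eta : 'I_n -> L), is_generic_zero J eta /\
  exists t0 : nat, forall t, (t0 <= t)%N ->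
    has_trdeg (trunc_field eta t) (d * t.+1 + h)%N.

End DiffPoly.

(* The difference monomials of order <= s and degree <= r in n indeterminates,
   given by the exponents of the y_j^(k), k <= s; the codomain 'I_r.+1 only
   makes the type finite. *)
Definition dmonom (n s r : nat) : finType :=
  {e : {ffun 'I_n * 'I_s.+1 -> 'I_r.+1} | (\sum_v e v <= r)%N}.

Section Generic.
Context (F : diffField) (n s r : nat).

Definition dmonom_poly (m : dmonom n s r) : {dpoly F[n]} :=
  \prod_v pvar F (v.1, val v.2) ^+ val m v.

Definition generic_poly (u : dmonom n s r -> F) : {dpoly F[n]} :=
  \sum_(m : dmonom n s r) u m *: dmonom_poly m.

End Generic.

(* Main.v *)
(* Let [eta] be a generic zero of [I]. Adjoin to F<eta> free coefficients [u_m], [m != 1],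
   and put [u_1 := - sum_(m != 1) u_m m(eta)]. Since [d > 0], at every order some
   [eta_j^(k+s)] is transcendental over the transforms of [eta] of lower order; the
   genericity of the coefficient of [y_j^(s)] makes [u_1^(k)] transcendental over the
   other coefficients and the transforms of [eta] of order below [k + s]. So the
   completed family [u] is transformally independent over F, F<u> embeds, and [eta] is a
   zero of the generic polynomial over F<u>. Eliminating the [u_1^(k)] by means of the
   transforms of the generic polynomial shows that [eta] is a generic zero of
   the new ideal. Of the [u_1^(k)], those with [k <= t - s] lie in the field generated by the
   other coefficients and the transforms of [eta] up to order [t], and the remaining ones
   are independent over that field; hence passing from F to F<u> lowers the
   transcendence degree d(t+1) + h by exactly t - s + 1. *)

From HB Require Import structures.
From mathcomp Require Import all_boot all_order all_algebra finmap.
From mathcomp Require Import boolp generic_quotient fraction.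
From mathcomp.multinomials Require Import monalg.
Require Import Defs.

Set Implicit Arguments.
Unset Strict Implicit.
Unset Printing Implicit Defensive.

Import GRing.Theory.
Local Open Scope ring_scope.

(** Degrees are treated as ranks in the matroid of algebraic closure, relative to a base set. One
    field is read both as an extension of [F] and, through an embedding [theta], of the given
    coefficient field [K], so that ranks over [F] and over F<u> are compared inside the same ambient
    field. Two obstacles shape the argument. The dimension and the order of [I] may be witnessed by
    different generic zeros and, a priori, by different slopes; hence ranks are shown to depend on
    the ideal alone and the dimension to be the linear growth rate of the ranks. The same criterion,
    used backwards, gives the dimension of the new ideal. Secondly, F<u> contains all the u_1^(k),
    infinitely many, while only those of low order interact with the transforms of eta up to order
    t; the remaining ones are discarded by a disjointness argument. Primality and reflexivity then
    come from the description of the new ideal as the set of polynomials vanishing at a point. *)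

Lemma malg_ind (R : comNzRingType) (I : choiceType)
    (P : {malg R[{cmonom I}]} -> Prop) :
  (forall c, P (malgC c)) -> (forall i, P (pvar R i)) ->
  (forall p q, P p -> P q -> P (p + q)) ->
  (forall p q, P p -> P q -> P (p * q)) -> forall p, P p.
Proof.
move=> PC PX PD PM p; rewrite (monalgE p).
have Pm (m : {cmonom I}) : P << m >>.
  have [k] := ubnP (mdeg m); elim: k m => // k IHk m lt_mk.
  have [->|m1] := eqVneq m (mone : {cmonom I}); first exact: (PC 1).
  have /fset0Pn[i im] : finsupp m != fset0.
    apply: contraNneq m1 => m0; apply/cmP => i.
    by apply/eqP; rewrite cm1 cmE_eq0 m0 in_fset0.
  have Dm : m = mmul (ucm i) (divcm m (ucm i)).
    apply/eqP/cmP => j; rewrite cmM divcmE cmU.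
    by case: eqP => [<-|_] //=; rewrite ?subnKC ?subn0 // lt0n cmE_neq0.
  rewrite Dm -[1]mulr1 -fgmulUU -malgM_def; apply: PM (PX i) (IHk _ _).
  by move: lt_mk; rewrite {1}Dm mdegM mdegU add1n ltnS.
rewrite big_seq; elim/big_ind: _ => [|p1 p2|m _]; first by rewrite -malgC0E; apply: PC.
  exact: PD.
have -> : << p@_m *g m >> = (p@_m)%:MP * << m >>.
  by apply/malgP => k; rewrite [LHS]mcoeffU mcoeffCM mcoeffU mulrnAr mulr1.
by apply: (PM).
Qed.

(** * Evaluation as a ring morphism *)

Section PevalMorphism.
Context (R S : comNzRingType) (I : choiceType).
Implicit Types (f : {rmorphism R -> S}) (v : I -> S).

Let meval v (m : {cmonom I}) := \prod_(i <- finsupp (cmonom_val m)) v i ^+ m i.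

Let mevalE v (m : {cmonom I}) (d : {fset I}) : (finsupp m `<=` d)%fset ->
  meval v m = \prod_(i <- d) v i ^+ m i.
Proof.
move=> md; apply: big_fset_incl => // i _; rewrite -cmE_eq0 => /eqP->.
by rewrite expr0.
Qed.

Let meval_morphism v : mmorphism (meval v).
Proof.
split=> [m1 m2|]; last by rewrite /meval mdom1 big_seq_fset0.
rewrite (@mevalE v m1 _ (fsubsetUl _ (finsupp m2))) /meval.
rewrite -/(meval v m2) (@mevalE v m2 _ (fsubsetUr (finsupp m1) _)) mdomD.
by rewrite -big_split; apply: eq_bigr => i _; rewrite cmM exprD.
Qed.

HB.instance Definition _ v := isMultiplicative.Build {cmonom I} S (meval v) (meval_morphism v).

Lemma peval_additive f v : zmod_morphism (peval f v).
Proof. exact: mmap_is_additive. Qed.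

Lemma peval_multiplicative f v : monoid_morphism (peval f v).
Proof.
have [m1 mM] := mmap_is_multiplicative (f := f) (h := meval v).
by split.
Qed.

End PevalMorphism.

HB.instance Definition _ (R S : comNzRingType) (I : choiceType)
    (f : {rmorphism R -> S}) (v : I -> S) :=
  GRing.isZmodMorphism.Build {malg R[{cmonom I}]} S (peval f v)
    (peval_additive f v).
HB.instance Definition _ (R S : comNzRingType) (I : choiceType)
    (f : {rmorphism R -> S}) (v : I -> S) :=
  GRing.isMonoidMorphism.Build {malg R[{cmonom I}]} S (peval f v)
    (peval_multiplicative f v).

Lemma pevalC (R S : comNzRingType) (I : choiceType) (f : {rmorphism R -> S})
  (v : I -> S) (c : R) : peval f v (malgC c) = f c.
Proof. by rewrite /peval mmapU mdom1 big_seq_fset0 mulr1. Qed.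

Lemma pevalX (R S : comNzRingType) (I : choiceType) (f : {rmorphism R -> S})
  (v : I -> S) (i : I) : peval f v (pvar R i) = v i.
Proof. by rewrite /peval mmapU /= rmorph1 mul1r mdomU big_seq_fset1 cmUU. Qed.

Lemma pevalE (R S : comNzRingType) (I : choiceType) (f : R -> S) (v : I -> S) p :
  peval f v p = \sum_(m <- msupp p)
    f p@_m * \prod_(i <- finsupp (cmonom_val m)) v i ^+ m i.
Proof. by []. Qed.

Lemma peval_monom (R S : comNzRingType) (I : choiceType) (f : {rmorphism R -> S})
  (v : I -> S) (m : {cmonom I}) :
  peval f v << m >> = \prod_(i <- finsupp (cmonom_val m)) v i ^+ m i.
Proof. by rewrite /peval mmapU /= rmorph1 mul1r. Qed.

Lemma pevalD (R S : comNzRingType) (I : choiceType) (f : {rmorphism R -> S})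
  (v : I -> S) : {morph peval f v : p q / p + q}.
Proof. exact: rmorphD. Qed.

Lemma pevalN (R S : comNzRingType) (I : choiceType) (f : {rmorphism R -> S})
  (v : I -> S) : {morph peval f v : p / - p}.
Proof. exact: rmorphN. Qed.

Lemma pevalM (R S : comNzRingType) (I : choiceType) (f : {rmorphism R -> S})
  (v : I -> S) : {morph peval f v : p q / p * q}.
Proof. exact: rmorphM. Qed.

Lemma malg_rmorph_eq (R S : comNzRingType) (I : choiceType)
    (f g : {rmorphism {malg R[{cmonom I}]} -> S}) :
  (forall c, f (malgC c) = g (malgC c)) ->
  (forall i, f (pvar R i) = g (pvar R i)) -> f =1 g.
Proof.
move=> eqC eqX; apply: malg_ind => // p q eq_p eq_q.
  by rewrite !rmorphD eq_p eq_q.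
by rewrite !rmorphM eq_p eq_q.
Qed.

Lemma peval_id (R : comNzRingType) (I : choiceType) (p : {malg R[{cmonom I}]}) :
  peval malgC (@pvar R I) p = p.
Proof.
apply: (malg_rmorph_eq (f := peval malgC (@pvar R I)) (g := idfun)) p => [c|i].
  by rewrite /= pevalC.
by rewrite /= pevalX.
Qed.

Lemma rmorph_peval (R S T : comNzRingType) (I : choiceType)
    (g : {rmorphism S -> T}) (f : {rmorphism R -> S}) (v : I -> S) p :
  g (peval f v p) = peval (g \o f) (g \o v) p.
Proof.
apply: (malg_rmorph_eq (f := g \o peval f v) (g := peval (g \o f) (g \o v))) p.
  by move=> c; rewrite /= !pevalC.
by move=> i; rewrite /= !pevalX.
Qed.

(* Without this, comparing two distinct polynomials unfolds their arithmetic. *)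
#[local] Opaque peval fgmul fgadd fgopp.

(** * Polynomials in a restricted set of variables *)

Section Support.
Context (R : comNzRingType) (I : choiceType).
Implicit Types (A B : I -> Prop) (p q : {malg R[{cmonom I}]}).

(** The subalgebra generated by the variables in [A]. The inductive form covers arbitrary, possibly
    infinite [A], and lets evaluation be studied by induction on the construction. *)
Inductive over A : {malg R[{cmonom I}]} -> Prop :=
| overC c : over A (malgC c)
| overX i : A i -> over A (pvar R i)
| overD p q : over A p -> over A q -> over A (p + q)
| overM p q : over A p -> over A q -> over A (p * q).

Lemma over0 A : over A 0.
Proof. by rewrite -malgC0E; apply: overC. Qed.

Lemma overN A p : over A p -> over A (- p).
Proof.
move=> Ap; rewrite -mulN1r -(rmorphN1 (@malgC {cmonom I} R)).
exact: overM (overC A (-1)) Ap.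
Qed.

Lemma over_sum A (J : Type) (r : seq J) (P : pred J) F :
  (forall j, P j -> over A (F j)) -> over A (\sum_(j <- r | P j) F j).
Proof. by move=> AF; elim/big_ind: _ => //; [apply: over0 | apply: overD]. Qed.

Lemma overS A B p : (forall i, A i -> B i) -> over A p -> over B p.
Proof.
move=> AB; elim=> {p} [c|i /AB|p q _ + _|p q _ + _]; first exact: overC.
- exact: overX.
- exact: overD.
- exact: overM.
Qed.

Lemma over_finite p : exists s : seq I, over (fun i => i \in s) p.
Proof.
elim/malg_ind: p => [c|i|p q [s sp] [t tq]|p q [s sp] [t tq]].
- by exists [::]; apply: overC.
- by exists [:: i]; apply: overX; rewrite inE.
- exists (s ++ t); apply: overD.
    by apply: overS sp => i si; rewrite mem_cat si.
  by apply: overS tq => i ti; rewrite mem_cat ti orbT.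
- exists (s ++ t); apply: overM.
    by apply: overS sp => i si; rewrite mem_cat si.
  by apply: overS tq => i ti; rewrite mem_cat ti orbT.
Qed.

Lemma over_set0 A p : (forall i, ~ A i) -> over A p -> exists c, p = malgC c.
Proof.
move=> A0; elim=> {p} [c|i /A0//|p q _ [c ->] _ [d ->]|p q _ [c ->] _ [d ->]].
- by exists c.
- by exists (c + d); rewrite raddfD.
- by exists (c * d); rewrite rmorphM.
Qed.

Lemma eq_over_peval (S : comNzRingType) (f : {rmorphism R -> S}) (v w : I -> S) A p :
  (forall i, A i -> v i = w i) -> over A p -> peval f v p = peval f w p.
Proof.
move=> vw; elim=> {p} [c|i /vw Ai|p q _ IHp _ IHq|p q _ IHp _ IHq].
- by rewrite !pevalC.
- by rewrite !pevalX.
- by rewrite !pevalD IHp IHq.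
- by rewrite !pevalM IHp IHq.
Qed.

(** The coefficients stay in the same ring rather than in one with a variable fewer, so inductions
    on the number of variables never change the type; [split_var_over] records that [i] has left
    them. *)
Definition split_var (i : I) : {malg R[{cmonom I}]} -> {poly {malg R[{cmonom I}]}} :=
  peval (polyC \o malgC) (fun j => if j == i then 'X else (pvar R j)%:P).

HB.instance Definition _ i := GRing.RMorphism.copy (split_var i)
  (peval (polyC \o malgC) (fun j => if j == i then 'X else (pvar R j)%:P)).

Lemma split_var_over i A p : over A p ->
  forall k, over (fun j => A j /\ j != i) (split_var i p)`_k.
Proof.
rewrite /split_var; elim=> {p} [c|j Aj|p q _ IHp _ IHq|p q _ IHp _ IHq] k.
- by rewrite pevalC coefC; case: ifP => _; [apply: overC | apply: over0].
- rewrite pevalX; case: eqP => [_|/eqP ji]; last first.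
    by rewrite coefC; case: ifP => _; [apply: overX | apply: over0].
  by rewrite coefX; case: (k == 1); [apply: (overC _ 1) | apply: over0].
- by rewrite pevalD coefD; exact (overD (IHp k) (IHq k)).
- by rewrite pevalM coefM; apply: over_sum => j _; exact (overM (IHp _) (IHq _)).
Qed.

Lemma split_var_eval (S : comNzRingType) (f : {rmorphism R -> S}) v i p :
  (map_poly (peval f v) (split_var i p)).[v i] = peval f v p.
Proof.
pose g := horner_eval (v i) \o map_poly (peval f v) \o split_var i.
apply: (malg_rmorph_eq (f := g) (g := peval f v)) p => [c|j] /=.
  by rewrite /horner_eval /split_var !pevalC /= map_polyC hornerC /= pevalC.
rewrite /horner_eval /split_var !pevalX; case: eqP => [->|_].
  by rewrite map_polyX hornerX.
by rewrite map_polyC hornerC /= pevalX.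
Qed.

Lemma split_var_inj0 i p : split_var i p = 0 -> p = 0.
Proof.
move=> p0; have := split_var_eval malgC (@pvar R I) i p.
by rewrite p0 rmorph0 horner0 peval_id.
Qed.

Lemma split_var_const i A p : over A p -> ~ A i -> split_var i p = p%:P.
Proof.
rewrite /split_var => + Ai; elim=> {p} [c|j Aj|p q _ IHp _ IHq|p q _ IHp _ IHq].
- by rewrite pevalC.
- by rewrite pevalX; case: eqP Aj => // ->.
- by rewrite pevalD IHp IHq -polyCD.
- by rewrite pevalM IHp IHq -polyCM.
Qed.

Lemma split_var_horner i A (c : {poly {malg R[{cmonom I}]}}) :
  (forall k, over A c`_k) -> ~ A i -> split_var i c.[pvar R i] = c.
Proof.
move=> Ac Ai; have Xi : split_var i (pvar R i) = 'X.
  by rewrite /split_var pevalX eqxx.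
rewrite -(horner_map (split_var i)) /= Xi.
rewrite (_ : map_poly _ c = map_poly polyC c); first exact: comp_polyXr.
by apply/polyP => k; rewrite !coef_map /= (split_var_const (Ac k) Ai).
Qed.

Lemma over_horner i A (c : {poly {malg R[{cmonom I}]}}) :
  A i -> (forall k, over A c`_k) -> over A c.[pvar R i].
Proof.
move=> Ai Ac; rewrite horner_coef; apply: over_sum => k _.
apply: overM => //; elim: (k : nat) => [|m IHm]; first exact: (overC A 1).
by rewrite exprS; apply: overM => //; apply: overX.
Qed.

End Support.

(** Two polynomials involve finitely many variables. By induction on their list, the leading
    coefficients with respect to one variable are nonzero and involve only the others, so their
    product is nonzero. *)
Lemma malg_integral (R : idomainType) (I : choiceType) :
  GRing.integral_domain_axiom {malg R[{cmonom I}]}.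
Proof.
move=> p q pq0; have [s sp] := over_finite p; have [t tq] := over_finite q.
have {sp}: over (fun i => i \in s ++ t) p.
  by apply: overS sp => i si; rewrite mem_cat si.
have {tq}: over (fun i => i \in s ++ t) q.
  by apply: overS tq => i ti; rewrite mem_cat ti orbT.
elim: (s ++ t) p q pq0 => [|i {}s IHs] p q pq0 sq sp.
  have [//|c Dp] := over_set0 _ sp; have [//|d Dq] := over_set0 _ sq.
  have /eqP : c * d = 0.
    by rewrite -[LHS](@malgCK {cmonom I} R) mpolyCM -Dp -Dq pq0 mcoeff0.
  rewrite mulf_eq0 => /orP[]/eqP c0; apply/orP; [left | right]; apply/eqP.
    by rewrite Dp c0 malgC0E.
  by rewrite Dq c0 malgC0E.
apply: contra_eqT pq0; rewrite negb_or => /andP[p0 q0].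
have nz (p' : {malg R[{cmonom I}]}) : p' != 0 -> lead_coef (split_var i p') != 0.
  by apply: contra_neq => /eqP; rewrite lead_coef_eq0 => /eqP /split_var_inj0.
have sm (p' : {malg R[{cmonom I}]}) : over (fun j => j \in i :: s) p' ->
    over (fun j => j \in s) (lead_coef (split_var i p')).
  move=> sp'; have := split_var_over i sp' (size (split_var i p')).-1.
  by apply: overS => j []; rewrite inE => /orP[/eqP->|//]; rewrite eqxx.
have lpq : lead_coef (split_var i p) * lead_coef (split_var i q) != 0.
  apply/eqP => lpq0; case/orP: (IHs _ _ lpq0 (sm q sq) (sm p sp)) => z.
    by move: (nz p p0); rewrite z.
  by move: (nz q q0); rewrite z.
have := lead_coef_proper_mul lpq; rewrite /split_var -pevalM => lE.
by apply: contraNneq lpq => pq0; rewrite -lE pq0 raddf0 lead_coef0.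
Qed.

(** * Free field extensions *)

(** A copy of the polynomial ring that carries the integral domain structure required by
    [{fraction _}]; its inverses are obtained by choice. *)
Definition free_ring (R : idomainType) (I : choiceType) : Type :=
  {malg R[{cmonom I}]}.

Section FreeField.
Context (R : idomainType) (I : choiceType).
Local Notation A := (free_ring R I).

HB.instance Definition _ := GRing.ComNzRing.copy A {malg R[{cmonom I}]}.

Let unit (p : A) : bool := `[< exists q, q * p = 1 >].
Let inv (p : A) : A := if pselect (exists q, q * p = 1) is left H then projT1 (cid H) else p.

Fact free_ring_mulV : {in unit, left_inverse 1 inv *%R}.
Proof.
by move=> p /asboolP pU; rewrite /inv; case: pselect => // H; case: cid.
Qed.

Fact free_ring_unitP (p q : A) : q * p = 1 -> unit p.
Proof. by move=> qp; apply/asboolP; exists q. Qed.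

Fact free_ring_inv_out : {in [predC unit], inv =1 id}.
Proof.
by move=> p /asboolPn pU; rewrite /inv; case: pselect.
Qed.

HB.instance Definition _ := GRing.ComNzRing_hasMulInverse.Build A
  free_ring_mulV free_ring_unitP free_ring_inv_out.
HB.instance Definition _ := GRing.ComUnitRing_isIntegral.Build A
  (@malg_integral R I).

End FreeField.

Section FractionSurjectivity.
Local Open Scope quotient_scope.

Lemma fractionP (R : idomainType) (z : {fraction R}) :
  exists p q : R, [/\ q != 0, tofrac q != 0 & z = tofrac p / tofrac q].
Proof.
elim/quotW: z => x; exists x.1, x.2; have x2 := denom_ratioP x.
split; rewrite ?tofrac_eq0 //; apply: (canRL (mulfK _)); rewrite ?tofrac_eq0 //.
change (FracField.mul (\pi_(FracField.type R) x) (tofrac x.2) = tofrac x.1).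
rewrite !piE; apply/eqmodP; rewrite /= FracField.equivfE /FracField.mulf /=.
by rewrite !numden_Ratio ?mulf_neq0 ?oner_neq0 // !mulr1 mulrC.
Qed.

End FractionSurjectivity.

(** The purely transcendental extension L(v). The second clause, that every element is a fraction,
    is what allows morphisms out of it to be defined on polynomials. *)
Lemma free_field (L : fieldType) (I : choiceType) :
  exists (M : fieldType) (iota : {rmorphism L -> M}) (v : I -> M),
    (forall p, peval iota v p = 0 -> p = 0) /\
    (forall z, exists p q, peval iota v q != 0 /\
       z = peval iota v p / peval iota v q).
Proof.
pose A := free_ring L I.
pose c : {rmorphism L -> A} := @malgC {cmonom I} L.
pose iota : {rmorphism L -> {fraction A}} := @tofrac A \o c.
pose v (i : I) : {fraction A} := @tofrac A (pvar L i).
have ev (p : A) : peval iota v p = tofrac p.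
  (* [tofrac] is a morphism on the copy [A]; its structure is rebuilt on the polynomial type itself
     so that [rmorph_peval] applies. *)
  pose t : {malg L[{cmonom I}]} -> {fraction A} := @tofrac A.
  have tB : zmod_morphism t by exact: (tofracB (R := A)).
  have tM : monoid_morphism t by split; [exact: tofrac1 | exact: (tofracM (R := A))].
  pose tz := GRing.isZmodMorphism.Build _ _ t tB.
  pose tm := GRing.isMonoidMorphism.Build _ _ t tM.
  pose t' : {rmorphism {malg L[{cmonom I}]} -> {fraction A}} := HB.pack t tz tm.
  have := rmorph_peval t' malgC (@pvar L I) p.
  by rewrite peval_id => ->.
exists {fraction A}, iota, v; split=> [p|z].
  by rewrite ev => /eqP; rewrite tofrac_eq0 => /eqP.
have [p [q [_ q0 ->]]] := fractionP z.
by exists p, q; rewrite !ev.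
Qed.

(** Equal kernels make x/y |-> g x / g y independent of the representative. It produces the shift of
    the free extension, the translation of a coefficient and the embedding of F<u>. *)
Lemma fraction_rmorphism (R : comNzRingType) (K L : fieldType)
    (f : {rmorphism R -> K}) (g : {rmorphism R -> L}) :
  (forall x, f x = 0 <-> g x = 0) ->
  (forall z, exists x y, f y != 0 /\ z = f x / f y) ->
  exists phi : {rmorphism K -> L}, forall x, phi (f x) = g x.
Proof.
move=> fg fracK.
have g0 y : f y != 0 -> g y != 0 by apply: contra_neq => /fg.
have key x y x' y' : f y != 0 -> f y' != 0 -> f x / f y = f x' / f y' ->
    g x / g y = g x' / g y'.
  move=> y0 y'0 /eqP; rewrite eqr_div // -!rmorphM -subr_eq0 -rmorphB => /eqP/fg.
  by rewrite rmorphB !rmorphM => /eqP; rewrite subr_eq0 -eqr_div ?g0 // => /eqP.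
have [phi phiP] : {phi : K -> L | forall x y, f y != 0 ->
    phi (f x / f y) = g x / g y}.
  have /choice[phi phiP] : forall z, exists t, exists x y,
      [/\ f y != 0, z = f x / f y & t = g x / g y].
    by move=> z; have [x [y [y0 ->]]] := fracK z; exists (g x / g y), x, y.
  exists phi => x y y0; have [x' [y' [y'0 e ->]]] := phiP (f x / f y).
  exact: key (esym e).
have phif x : phi (f x) = g x.
  have := phiP x 1; rewrite !rmorph1 !divr1; apply; exact: oner_neq0.
have phiB : zmod_morphism phi.
  move=> z t; have [x [y [y0 ->]]] := fracK z; have [x' [y' [y'0 ->]]] := fracK t.
  rewrite -mulNr -rmorphN addf_div // -!rmorphM -rmorphD !phiP //; last first.
    by rewrite rmorphM mulf_neq0.
  by rewrite rmorphD !rmorphM rmorphN -addf_div ?g0 // mulNr.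
have phiM : monoid_morphism phi.
  split=> [|z t]; first by rewrite -(rmorph1 f) phif rmorph1.
  have [x [y [y0 ->]]] := fracK z; have [x' [y' [y'0 ->]]] := fracK t.
  rewrite mulf_div -!rmorphM !phiP ?rmorphM ?mulf_neq0 //.
  by rewrite mulf_div.
pose aM := GRing.isZmodMorphism.Build K L phi phiB.
pose mM := GRing.isMonoidMorphism.Build K L phi phiM.
pose phi' : {rmorphism K -> L} := HB.pack phi aM mM.
by exists phi'.
Qed.

(** * Algebraic closure and rank *)

Section Closure.
Context (L : fieldType).
Implicit Types (B C : L -> Prop) (x y z : L) (p q : {poly L}).

(** A ground field is not a parameter: it is put into [B]. Bases can thus grow or shrink without any
    change of type. *)
Inductive fgen B : L -> Prop :=
| fgen_in x : B x -> fgen B x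
| fgen1 : fgen B 1
| fgenB x y : fgen B x -> fgen B y -> fgen B (x - y)
| fgenM x y : fgen B x -> fgen B y -> fgen B (x * y)
| fgenV x : fgen B x -> fgen B x^-1.

Inductive rgen B : L -> Prop :=
| rgen_in x : B x -> rgen B x
| rgen1 : rgen B 1
| rgenB x y : rgen B x -> rgen B y -> rgen B (x - y)
| rgenM x y : rgen B x -> rgen B y -> rgen B (x * y).

Lemma fgen0 B : fgen B 0.
Proof. by rewrite -(subrr 1); apply: fgenB; apply: fgen1. Qed.

Lemma rgen0 B : rgen B 0.
Proof. by rewrite -(subrr 1); apply: rgenB; apply: rgen1. Qed.

Lemma fgenD B x y : fgen B x -> fgen B y -> fgen B (x + y).
Proof.
move=> Bx By; rewrite -[y]opprK; apply: fgenB => //; rewrite -sub0r.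
by apply: fgenB => //; apply: fgen0.
Qed.

Lemma rgenD B x y : rgen B x -> rgen B y -> rgen B (x + y).
Proof.
move=> Bx By; rewrite -[y]opprK; apply: rgenB => //; rewrite -sub0r.
by apply: rgenB => //; apply: rgen0.
Qed.

Lemma rgen_fgen B x : rgen B x -> fgen B x.
Proof.
elim=> {x} [x|||]; [exact: fgen_in | exact: fgen1 | |] => x y _ + _.
- exact: fgenB.
- exact: fgenM.
Qed.

Lemma fgen_sub B C x : (forall y, B y -> fgen C y) -> fgen B x -> fgen C x.
Proof.
move=> BC; elim=> {x} [x||x y _ + _|x y _ + _|x _].
- exact: BC.
- exact: fgen1.
- exact: fgenB.
- exact: fgenM.
- exact: fgenV.
Qed.

Lemma rgen_sub B C x : (forall y, B y -> rgen C y) -> rgen B x -> rgen C x.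
Proof.
move=> BC; elim=> {x} [x||x y _ + _|x y _ + _].
- exact: BC.
- exact: rgen1.
- exact: rgenB.
- exact: rgenM.
Qed.

Lemma fgen_fraction B z :
  fgen B z -> exists x y, [/\ rgen B x, rgen B y, y != 0 & z = x / y].
Proof.
elim=> {z} [z Bz||z t _ [a [b [Ba Bb b0 ->]]] _ [c [d [Bc Bd d0 ->]]]
  |z t _ [a [b [Ba Bb b0 ->]]] _ [c [d [Bc Bd d0 ->]]]|z _ [a [b [Ba Bb b0 ->]]]].
- by exists z, 1; rewrite oner_neq0 divr1; split=> //; [apply: rgen_in | apply: rgen1].
- by exists 1, 1; rewrite oner_neq0 divr1; split=> //; apply: rgen1.
- exists (a * d - c * b), (b * d); split; last by rewrite -mulNr addf_div // mulNr.
  + by apply: rgenB; apply: rgenM.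
  + exact: rgenM.
  + exact: mulf_neq0.
- exists (a * c), (b * d); rewrite mulf_div; split=> //; last exact: mulf_neq0.
  + exact: rgenM.
  + exact: rgenM.
- have [->|a0] := eqVneq a 0.
    exists 0, 1; rewrite mul0r invr0 mul0r oner_neq0.
    by split=> //; [apply: rgen0 | apply: rgen1].
  by exists b, a; rewrite invf_div.
Qed.

Definition acl B x : Prop :=
  exists p, [/\ p != 0, root p x & forall i, fgen B p`_i].

(** Clears denominators: polynomial expressions in [B] can be rewritten as polynomials in a chosen
    element, which fractions do not allow directly. *)
Lemma acl_rgenP B x :
  acl B x <-> exists p, [/\ p != 0, root p x & forall i, rgen B p`_i].
Proof.
split=> -[p [p0 px Bp]]; last first.
  by exists p; split=> // i; apply: rgen_fgen.
have [c [c0 Bc cp]] : exists c, [/\ c != 0, rgen B c &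
    forall i, (i < size p)%N -> rgen B (c * p`_i)].
  elim: (size p) => [|m [c [c0 Bc cp]]].
    by exists 1; rewrite oner_neq0; split=> //; apply: rgen1.
  have [a [b [Ba Bb b0 pm]]] := fgen_fraction (Bp m).
  exists (c * b); split; [exact: mulf_neq0 | exact: rgenM |] => i.
  rewrite ltnS leq_eqVlt => /orP[/eqP->|/cp Bi]; last first.
    by rewrite mulrAC; apply: rgenM.
  by rewrite pm -mulrA [b * _]mulrC divfK //; apply: rgenM.
exists (c *: p); split=> [||i].
- by rewrite scaler_eq0 negb_or c0.
- by rewrite rootZ.
- rewrite coefZ; have [/cp//|le_pi] := ltnP i (size p).
  by rewrite (nth_default _ le_pi) mulr0; apply: rgen0.
Qed.

Section Subfield.
Context (B : L -> Prop).

Definition fgen_pred : {pred L} := fun x => `[< fgen B x >].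

Fact fgen_divring : divring_closed fgen_pred.
Proof.
split=> [|x y /asboolP Bx /asboolP By|x y /asboolP Bx /asboolP By]; apply/asboolP.
- exact: fgen1.
- exact: fgenB.
- by apply: fgenM => //; apply: fgenV.
Qed.
HB.instance Definition _ := GRing.isDivringClosed.Build L fgen_pred fgen_divring.

Definition fgen_type := {x : L | fgen_pred x}.
HB.instance Definition _ := SubType.on fgen_type.
HB.instance Definition _ := Choice.on fgen_type.
HB.instance Definition _ := [SubChoice_isSubIntegralDomain of fgen_type by <:].
HB.instance Definition _ := [SubIntegralDomain_isSubField of fgen_type by <:].

Definition fgen_val : {rmorphism fgen_type -> L} := val : fgen_type -> L.

(** The subfield is made a type for the sake of this bridge: closure of [acl] under the field
    operations is inherited from [algebraicOver]. *)
Lemma aclE x : acl B x <-> algebraicOver fgen_val x.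
Proof.
split=> -[p].
  move=> [p0 px Bp]; have Bp' i : fgen_pred p`_i by apply/asboolP.
  have Dp : map_poly fgen_val (\poly_(i < size p) (Sub p`_i (Bp' i) : fgen_type)) = p.
    apply/polyP => i; rewrite coef_map coef_poly /=; case: ltnP => // ?.
    by rewrite nth_default.
  by exists (\poly_(i < size p) Sub p`_i (Bp' i)); rewrite ?Dp // -(map_poly_eq0 fgen_val) Dp.
move=> p0 px; exists (map_poly fgen_val p); rewrite map_poly_eq0; split=> // i.
by rewrite coef_map; apply/asboolP; exact: (valP (p`_i : fgen_type)).
Qed.

End Subfield.

Lemma acl_fgen B x : fgen B x -> acl B x.
Proof.
move=> Bx; exists ('X - x%:P); rewrite polyXsubC_eq0 root_XsubC; split=> // i.
rewrite coefB coefX coefC; apply: fgenB.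
  by case: (i == 1)%N; [apply: fgen1 | apply: fgen0].
by case: eqP => // _; apply: fgen0.
Qed.

Lemma acl_in B x : B x -> acl B x.
Proof. by move=> Bx; apply/acl_fgen/fgen_in. Qed.

Lemma acl_closed B x : fgen (acl B) x -> acl B x.
Proof.
elim=> {x} [//||x y _ /aclE Bx _ /aclE By|x y _ /aclE Bx _ /aclE By|x _ /aclE Bx].
- exact/acl_fgen/fgen1.
- exact/aclE/algebraic_sub.
- exact/aclE/algebraic_mul.
- exact/aclE/algebraic_inv.
Qed.

Lemma acl_trans B C x : (forall y, B y -> acl C y) -> acl B x -> acl C x.
Proof.
move=> BC [p [p0 px Bp]]; apply/aclE/integral_algebraic.
apply: (integral_root p0 px); apply/integral_poly => i.
apply/integral_algebraic/aclE/acl_closed.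
by apply: fgen_sub (Bp i) => y /BC By; apply: fgen_in.
Qed.

Lemma acl_mono B C x : (forall y, B y -> C y) -> acl B x -> acl C x.
Proof. by move=> BC; apply: acl_trans => y /BC; apply: acl_in. Qed.

End Closure.

Definition setjoin (T : Type) (B C : T -> Prop) : T -> Prop := fun x => B x \/ C x.
Definition inseq (T : eqType) (s : seq T) : T -> Prop := fun x => x \in s.

Section Exchange.
Context (L : fieldType).
Implicit Types (B C : L -> Prop) (x y z : L) (s t : seq L).

Lemma rgen_horner B y z : rgen (fun x => B x \/ x = y) z ->
  exists2 p : {poly L}, forall i, rgen B p`_i & z = p.[y].
Proof.
elim=> {z} [z [Bz|->]||z t _ [p Bp ->] _ [q Bq ->]|z t _ [p Bp ->] _ [q Bq ->]].
- exists z%:P => [i|]; last by rewrite hornerC.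
  by rewrite coefC; case: eqP => _; [apply: rgen_in | apply: rgen0].
- exists 'X => [i|]; last by rewrite hornerX.
  by rewrite coefX; case: eqP => _; [apply: rgen1 | apply: rgen0].
- exists 1 => [i|]; last by rewrite hornerC.
  by rewrite coef1; case: eqP => _; [apply: rgen1 | apply: rgen0].
- by exists (p - q) => [i|]; [rewrite coefB; apply: rgenB | rewrite hornerD hornerN].
- exists (p * q) => [i|]; last by rewrite hornerM.
  rewrite coefM; elim/big_ind: _ => [|? ?|j _]; first exact: rgen0.
    exact: rgenD.
  exact: rgenM.
Qed.

(** Write the coefficients of an equation of [x] as [P i] evaluated at [y] and exchange the roles:
    the sum [H] of the x^i P_i vanishes at [y]. If [H] were zero, the j-th coefficients of the [P i]
    would form an equation of [x] over [B], nonzero for a suitable j. *)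
Lemma acl_exchange B x y : acl (fun z => B z \/ z = y) x -> ~ acl B x ->
  acl (fun z => B z \/ z = x) y.
Proof.
move=> /acl_rgenP[p [p0 px Bp]] Bx.
have /choice[P PP] : forall i, exists q : {poly L},
    (forall j, rgen B q`_j) /\ p`_i = q.[y].
  by move=> i; have [q] := rgen_horner (Bp i); exists q.
pose H := \sum_(i < size p) x ^+ i *: P i.
have rgx i : rgen (fun z => B z \/ z = x) (x ^+ i).
  elim: i => [|i IHi]; first exact: rgen1.
  by rewrite exprS; apply: rgenM => //; apply: rgen_in; right.
apply/acl_rgenP; exists H; split=> [||j]; last 1 first.
- rewrite coef_sum; elim/big_ind: _ => [|? ?|i _]; first exact: rgen0.
    exact: rgenD.
  rewrite coefZ; apply: rgenM => //; have [Pi _] := PP i.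
  by apply: rgen_sub (Pi j) => z Bz; apply: rgen_in; left.
- apply: contra_notN Bx => /eqP H0; apply/acl_rgenP.
  have [i pi0] : exists i, p`_i != 0.
    by exists (size p).-1; rewrite -lead_coefE lead_coef_eq0.
  have [j Pij0] : exists j, (P i)`_j != 0.
    have Pi0 : P i != 0.
      by apply: contraNneq pi0 => Pi0; have [_ ->] := PP i; rewrite Pi0 horner0.
    by exists (size (P i)).-1; rewrite -lead_coefE lead_coef_eq0.
  have lti : (i < size p)%N by apply: contraNT pi0; rewrite -leqNgt => /(nth_default 0)->.
  exists (\poly_(k < size p) (P k)`_j); split=> [||k].
  - by apply: contraNneq Pij0 => /polyP/(_ i); rewrite coef_poly lti coef0 => ->.
  - rewrite /root horner_poly; apply/eqP; transitivity (H`_j).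
      by rewrite coef_sum; apply: eq_bigr => k _; rewrite coefZ mulrC.
    by rewrite H0 coef0.
  - rewrite coef_poly; case: ifP => _; last exact: rgen0.
    by have [Pk _] := PP k.
- rewrite /root horner_sum; apply/eqP; transitivity p.[x]; last exact/eqP.
  rewrite horner_coef; apply: eq_bigr => i _.
  by have [_ ->] := PP i; rewrite hornerZ mulrC.
Qed.

Lemma fgen_finite B x : fgen B x ->
  exists2 s : seq L, forall y, y \in s -> B y & fgen (inseq s) x.
Proof.
have cat1 s t : forall y, inseq s y -> fgen (inseq (s ++ t)) y.
  by move=> y sy; apply: fgen_in; rewrite /inseq mem_cat [y \in s]sy.
have cat2 s t : forall y, inseq t y -> fgen (inseq (s ++ t)) y.
  by move=> y sy; apply: fgen_in; rewrite /inseq mem_cat [y \in t]sy orbT.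
have catB s t : (forall y, y \in s -> B y) -> (forall y, y \in t -> B y) ->
    forall y, y \in s ++ t -> B y.
  by move=> sB tB y; rewrite mem_cat => /orP[/sB|/tB].
elim=> {x} [x Bx||x y _ [s sB sx] _ [t tB ty]|x y _ [s sB sx] _ [t tB ty]
  |x _ [s sB sx]].
- exists [:: x]; first by move=> y; rewrite inE => /eqP->.
  by apply: fgen_in; rewrite /inseq inE.
- by exists [::] => //; apply: fgen1.
- exists (s ++ t); first exact: catB.
  by apply: fgenB; [exact: (fgen_sub (@cat1 s t)) sx | exact: (fgen_sub (@cat2 s t)) ty].
- exists (s ++ t); first exact: catB.
  by apply: fgenM; [exact: (fgen_sub (@cat1 s t)) sx | exact: (fgen_sub (@cat2 s t)) ty].
- by exists s => //; apply: fgenV.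
Qed.

Lemma acl_finite B x : acl B x ->
  exists2 s : seq L, forall y, y \in s -> B y & acl (inseq s) x.
Proof.
move=> [p [p0 px Bp]].
have [s sB sp] : exists2 s : seq L, forall y, y \in s -> B y &
    forall i, (i < size p)%N -> fgen (inseq s) p`_i.
  elim: (size p) => [|m [s sB sp]]; first by exists [::] => [y|]; rewrite ?in_nil.
  have [t tB tm] := fgen_finite (Bp m); exists (s ++ t) => [y|i].
    by rewrite mem_cat => /orP[/sB|/tB].
  rewrite ltnS leq_eqVlt => /orP[/eqP->|/sp si].
    by apply: fgen_sub tm => y ty; apply: fgen_in; rewrite /inseq mem_cat [y \in t]ty orbT.
  by apply: fgen_sub si => y ty; apply: fgen_in; rewrite /inseq mem_cat [y \in s]ty.
exists s => //; exists p; split=> // i.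
by have [/sp//|/(nth_default 0)->] := ltnP i (size p); apply: fgen0.
Qed.

End Exchange.

Definition image_set (T U : Type) (f : T -> U) (B : T -> Prop) : U -> Prop :=
  fun y => exists2 x, B x & y = f x.

Lemma fgen_image (L M : fieldType) (f : {rmorphism L -> M}) (B : L -> Prop) x :
  fgen B x -> fgen (image_set f B) (f x).
Proof.
elim=> {x} [x Bx||x y _ + _|x y _ + _|x _].
- by apply: fgen_in; exists x.
- by rewrite rmorph1; apply: fgen1.
- by rewrite rmorphB; apply: fgenB.
- by rewrite rmorphM; apply: fgenM.
- by rewrite fmorphV; apply: fgenV.
Qed.

Lemma acl_image (L M : fieldType) (f : {rmorphism L -> M}) (B : L -> Prop) x :
  acl B x -> acl (image_set f B) (f x).
Proof.
move=> [p [p0 px Bp]]; exists (map_poly f p); rewrite map_poly_eq0 fmorph_root.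
by split=> // i; rewrite coef_map; apply: fgen_image.
Qed.

Section Rank.
Context (L : fieldType).
Implicit Types (B C X : L -> Prop) (x y z : L) (s t : seq L).

(** Each entry is transcendental over [B] and the entries after it. This excludes repetitions, and
    it means that a list is built from its tail: whatever is adjoined last stands first. *)
Fixpoint indep B s : Prop :=
  if s is x :: s' then indep B s' /\ ~ acl (setjoin B (inseq s')) x else True.

Lemma acl_join B C s x : (forall y, B y -> acl C y) ->
  acl (setjoin B (inseq s)) x -> acl (setjoin C (inseq s)) x.
Proof.
move=> BC; apply: acl_trans => y [/BC|sy]; last by apply: acl_in; right.
by apply: acl_mono => z; left.
Qed.

Lemma indep_mono B C s : (forall x, B x -> acl C x) -> indep C s -> indep B s.
Proof.
move=> BC; elim: s => //= x s IHs [/IHs Bs Cx]; split=> //.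
by move=> Bx; apply: Cx; apply: acl_join Bx.
Qed.

Lemma acl_exchange_seq B s x y :
  acl (setjoin B (inseq (y :: s))) x -> ~ acl (setjoin B (inseq s)) x ->
  acl (setjoin B (inseq (x :: s))) y.
Proof.
move=> yx nx; have := @acl_exchange _ (setjoin B (inseq s)) x y.
have set1 z w : acl (fun u => setjoin B (inseq s) u \/ u = z) w <->
    acl (setjoin B (inseq (z :: s))) w.
  by split; apply: acl_mono => u; rewrite /setjoin /inseq inE;
    [case=> [[]|->]; rewrite ?eqxx; auto => ->; rewrite orbT; auto
    | case=> [|/orP[/eqP->|]]; auto].
by rewrite !set1; apply.
Qed.

Lemma indep_adjoin B s y : indep B s -> ~ acl (setjoin B (inseq s)) y ->
  indep (setjoin B (inseq [:: y])) s.
Proof.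
elim: s => //= x s IHs [Bs nx] ny; split.
  apply: IHs => // sy; apply: ny; apply: acl_mono sy => z [|sz]; first by left.
  by right; rewrite /inseq inE [z \in s]sz orbT.
move=> yx; apply: ny; apply: acl_exchange_seq nx.
apply: acl_mono yx => z [[|]|]; first by left.
  by rewrite /inseq inE => zy; right; rewrite /inseq inE zy.
by move=> sz; right; rewrite /inseq inE [z \in s]sz orbT.
Qed.

(** The Steinitz step: moving [y] into the base costs at most one entry. *)
Lemma indep_drop B s y : indep B s -> exists t,
  [/\ {subset t <= s}, (size s <= (size t).+1)%N &
      indep (setjoin B (inseq [:: y])) t].
Proof.
elim: s => [|x s IHs] /=; first by exists [::].
case=> Bs nx; have [Bys|nBys] := lem (indep (setjoin B (inseq [:: y])) s).
  by exists s; split=> // z sz; rewrite inE sz orbT.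
(* If the tail does not survive the adjunction of [y], then [y] depends on the tail; the loss occurs
   there and the head [x] can be kept. *)
have sy : acl (setjoin B (inseq s)) y.
  by apply: contrapT => /(indep_adjoin Bs).
have [t [ts st Bt]] := IHs Bs; exists (x :: t); split=> [z||/=]; last 1 first.
- split=> // tx; apply: nx; apply: acl_trans tx => z [[|]|].
  + by move=> Bz; apply: acl_in; left.
  + by rewrite /inseq inE => /eqP->.
  + by move=> /ts sz; apply: acl_in; right.
- by rewrite !inE => /orP[->//|/ts->]; rewrite orbT.
- by [].
Qed.

Lemma indep_leq_size B s t : indep B s ->
  (forall x, x \in s -> acl (setjoin B (inseq t)) x) -> (size s <= size t)%N.
Proof.
elim: t B s => [|y t IHt] B s Bs st.
  case: s Bs st => //= x s [_ nx] /(_ x (mem_head _ _)) Bx; case: nx.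
  by apply: acl_mono Bx => z [|//]; left.
have [s' [s's ss' Bs']] := indep_drop y Bs.
apply: leq_trans ss' _; rewrite ltnS; apply: IHt Bs' _ => x /s's /st.
apply: acl_mono => z [|]; first by left; left.
by rewrite /inseq inE => /orP[zy|]; [left; right; rewrite /inseq inE | right].
Qed.

Lemma indep_cat B s t :
  indep B (s ++ t) <-> indep B t /\ indep (setjoin B (inseq t)) s.
Proof.
have eqJ s' x : acl (setjoin (setjoin B (inseq t)) (inseq s')) x <->
    acl (setjoin B (inseq (s' ++ t))) x.
  split; apply: acl_mono => z; rewrite /setjoin /inseq mem_cat.
    by case=> [[]|] => [|->|->]; rewrite ?orbT; auto.
  by case=> [|/orP[]]; auto.
elim: s => [|x s IHs] /=; first by tauto.
by rewrite IHs eqJ; tauto.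
Qed.

(** The transcendence degree of B(X) over the field generated by [B], with a basis taken from
    [X]. *)
Definition has_rank B X (n : nat) : Prop := exists s, [/\ size s = n,
  forall x, x \in s -> X x, indep B s & forall x, X x -> acl (setjoin B (inseq s)) x].

Lemma has_rank_leq B X s n : has_rank B X n -> indep B s ->
  (forall x, x \in s -> acl (setjoin B X) x) -> (size s <= n)%N.
Proof.
move=> [t [<- tX _ Xt]] Bs sX; apply: indep_leq_size Bs _ => x /sX.
by apply: acl_trans => z [Bz|/Xt//]; apply: acl_in; left.
Qed.

Lemma has_rank_geq B X t n : has_rank B X n ->
  (forall x, X x -> acl (setjoin B (inseq t)) x) -> (n <= size t)%N.
Proof.
by move=> [s [<- sX Bs _]] Xt; apply: indep_leq_size Bs _ => x /sX/Xt.
Qed.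

Lemma has_rank_uniq B C X Y m n :
  (forall x, B x -> acl C x) -> (forall x, C x -> acl B x) ->
  (forall x, X x -> acl (setjoin C Y) x) -> (forall x, Y x -> acl (setjoin B X) x) ->
  has_rank B X m -> has_rank C Y n -> m = n.
Proof.
have half B' C' X' Y' m' n' : (forall x, C' x -> acl B' x) ->
    (forall x, X' x -> acl (setjoin C' Y') x) ->
    has_rank B' X' m' -> has_rank C' Y' n' -> (m' <= n')%N.
  move=> CB XY [s [<- sX Bs _]] rY; apply: has_rank_leq rY _ _ => [|x /sX/XY//].
  exact: indep_mono Bs.
move=> BC CB XY YX rX rY; apply/eqP; rewrite eqn_leq.
by rewrite (half _ _ _ _ _ _ CB XY rX rY) (half _ _ _ _ _ _ BC YX rY rX).
Qed.

End Rank.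

(** * Absence of polynomial relations versus independence for algebraic closure *)

Section AlgebraicIndependence.
Context (F L : fieldType) (e : {rmorphism F -> L}).
Implicit Type (I : choiceType).

Definition rmorph_range : L -> Prop := fun x => exists a, x = e a.

Definition indep_on I (b : I -> L) (s : seq I) : Prop :=
  forall p, over (inseq s) p -> peval e b p = 0 -> p = 0.

Lemma over_rgen I (b : I -> L) (s : seq I) p : over (inseq s) p ->
  rgen (setjoin rmorph_range (inseq (map b s))) (peval e b p).
Proof.
elim=> {p} [c|i si|p q _ IHp _ IHq|p q _ IHp _ IHq].
- by rewrite pevalC; apply: rgen_in; left; exists c.
- by rewrite pevalX; apply: rgen_in; right; apply: map_f.
- by rewrite pevalD; exact (rgenD IHp IHq).
- by rewrite pevalM; exact (rgenM IHp IHq).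
Qed.

Lemma rgen_over I (b : I -> L) (A : I -> Prop) (B : L -> Prop) z :
  (forall y, B y -> rmorph_range y \/ exists2 i, A i & y = b i) ->
  rgen B z -> exists2 p, over A p & z = peval e b p.
Proof.
move=> BA; elim=> {z} [z|||].
- case/BA=> [[a ->]|[i Ai ->]].
    by exists (malgC a); [exact: overC | rewrite pevalC].
  by exists (pvar F i); [exact: overX | rewrite pevalX].
- by exists (malgC 1); [exact: overC | rewrite pevalC rmorph1].
- move=> x y _ [p Ap ->] _ [q Aq ->]; exists (p + malgC (-1) * q).
    by apply: overD => //; apply: overM => //; apply: overC.
  by rewrite pevalD pevalM pevalC rmorphN1 mulN1r.
- move=> x y _ [p Ap ->] _ [q Aq ->]; exists (p * q); last by rewrite pevalM.
  exact: overM.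
Qed.

Lemma indep_onS I (b : I -> L) (s t : seq I) :
  {subset s <= t} -> indep_on b t -> indep_on b s.
Proof. by move=> st bt p sp; apply: bt; apply: overS sp. Qed.

(** An equation of [b i] over the other values lifts to a polynomial in the variable [i];
    conversely, a relation split along [i] is an equation of [b i]. Without [uniq] a repeated index
    would break [indep] but not [indep_on]. *)
Lemma indep_onP I (b : I -> L) (s : seq I) : uniq s ->
  indep_on b s <-> indep rmorph_range (map b s).
Proof.
elim: s => [_|i s IHs /= /andP[si /IHs{}IHs]].
  split=> // _ p p0; have [//|c Dp] := over_set0 _ p0.
  by rewrite Dp pevalC => /eqP; rewrite fmorph_eq0 => /eqP->; apply: malgC0E.
split=> [bis|[/IHs bs nbi] p isp p0].
  split; first by apply/IHs; apply: indep_onS bis => j sj; rewrite inE sj orbT.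
  move=> /acl_rgenP[p [p0 pbi rp]].
  have /choice[c cP] : forall k, exists q, over (inseq s) q /\ p`_k = peval e b q.
    move=> k; have [|q sq Dpk] := rgen_over (A := inseq s) (b := b) _ (rp k).
      by move=> y [|/mapP[j sj ->]]; [left | right; exists j].
    by exists q.
  pose P := \poly_(k < size p) c k.
  have Ps k : over (inseq s) P`_k.
    rewrite coef_poly; case: ifP => _; last exact: over0.
    by have [] := cP k.
  have mapP : map_poly (peval e b) P = p.
    apply/polyP => k; rewrite coef_map coef_poly; case: ltnP => [_|lek].
      by have [_ ->] := cP k.
    by rewrite raddf0 nth_default.
  have nsi : ~ inseq s i by apply/negP.
  have P0 : P.[pvar F i] = 0.
    apply: bis.
      apply: over_horner => [|k]; first exact: mem_head.
      by apply: overS (Ps k) => j sj; rewrite /inseq inE [j \in s]sj orbT.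
    have := horner_map (peval e b) P (pvar F i).
    by rewrite /= pevalX mapP => <-; apply/eqP.
  have P00 : P = 0 by rewrite -(split_var_horner Ps nsi) P0 raddf0.
  by move: p0; rewrite -mapP P00 rmorph0 eqxx.
apply: (@split_var_inj0 _ _ i); apply/polyP => k; rewrite coef0.
have sk j : over (inseq s) (split_var i p)`_j.
  apply: overS (split_var_over i isp j) => l [].
  by rewrite /inseq inE => /orP[/eqP->|//]; rewrite eqxx.
apply: bs => //; apply: contrapT => pk0; apply: nbi.
exists (map_poly (peval e b) (split_var i p)); split=> [||j].
- by apply: contra_notN pk0 => /eqP/polyP/(_ k); rewrite coef_map coef0.
- by rewrite /root split_var_eval p0.
- by rewrite coef_map; apply: rgen_fgen; apply: over_rgen.
Qed.

Lemma peval_injP I (b : I -> L) :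
  (forall p, peval e b p = 0 -> p = 0) <->
  (forall s : seq I, uniq s -> indep rmorph_range (map b s)).
Proof.
split=> [b_inj s us|bP p p0]; first by apply/indep_onP => // p _; apply: b_inj.
have [s sp] := over_finite p; have us := undup_uniq s.
have /indep_onP/(_ p) := bP _ us; apply=> //.
by apply: overS sp => i; rewrite /inseq mem_undup.
Qed.

Lemma indep_perm I (b : I -> L) (s t : seq I) : uniq s -> uniq t ->
  {subset s <= t} -> indep rmorph_range (map b t) -> indep rmorph_range (map b s).
Proof.
move=> us ut st /(indep_onP _ ut) bt; apply/(indep_onP _ us).
exact: indep_onS bt.
Qed.

End AlgebraicIndependence.

Section TranscendenceDegree.
Context (F : diffField) (L : diffExt F).

Definition base_set : L -> Prop := rmorph_range (emb L).

Lemma alg_indepP (I : choiceType) (b : I -> L) :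
  alg_indep b <-> forall s : seq I, uniq s -> indep base_set (map b s).
Proof. exact: peval_injP. Qed.

Lemma alg_indep_finP (I : finType) (b : I -> L) :
  alg_indep b <-> indep base_set (map b (enum I)).
Proof.
rewrite alg_indepP; split=> [|bI s us]; first by apply; exact: enum_uniq.
by apply: indep_perm bI => // [|i _]; rewrite ?enum_uniq ?mem_enum.
Qed.

Lemma extend_alg_indepP (m : nat) (b : 'I_m -> L) x : alg_indep b ->
  ~ alg_indep (extend_family b x) <->
  acl (setjoin base_set (inseq (map b (enum 'I_m)))) x.
Proof.
move=> bI; pose s := None :: map Some (enum 'I_m).
have us : uniq s.
  by rewrite /= (map_inj_uniq Some_inj) enum_uniq andbT; apply/mapP => -[].
have sE : map (extend_family b x) s = x :: map b (enum 'I_m).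
  by rewrite /= -map_comp.
have -> : alg_indep (extend_family b x) <-> indep base_set (map (extend_family b x) s).
  rewrite alg_indepP; split=> [|bs t ut]; first exact.
  apply: indep_perm bs => // -[i _|]; rewrite inE ?eqxx //=.
  by apply: map_f; rewrite mem_enum.
rewrite sE /=; split=> [nb|? [_]//].
by apply: contrapT => nx; apply: nb; split=> //; apply/alg_indep_finP.
Qed.

Lemma has_trdegP (E : L -> Prop) m : has_trdeg E m <-> has_rank base_set E m.
Proof.
split=> [[b [Eb bI bmax]]|[s [<- Es sI smax]]].
  exists (map b (enum 'I_m)); rewrite size_map size_enum_ord; split=> //.
  - by move=> x /mapP[i _ ->].
  - exact/alg_indep_finP.
  - by move=> x Ex; apply/(extend_alg_indepP _ bI); apply: bmax.
pose b (i : 'I_(size s)) := tnth (in_tuple s) i.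
have bE : map b (enum 'I_(size s)) = s.
  by rewrite -[RHS]/(tval (in_tuple s)) -map_tnth_enum.
have bI : alg_indep b by apply/alg_indep_finP; rewrite bE.
exists b; split=> // [i|x Ex]; first by apply: Es; apply: mem_tnth.
by apply/extend_alg_indepP => //; rewrite bE; apply: smax.
Qed.

End TranscendenceDegree.

Arguments base_set {F} L _.

(** * Transformal transcendence degree *)

Section TransformMorphism.
Context (F : diffField).

Fact transform_zmod_morphism k : zmod_morphism (@transform F k).
Proof. by elim: k => [|k IHk] x y //=; rewrite /transform /= -!/(transform _ _) IHk rmorphB. Qed.

Fact transform_monoid_morphism k : monoid_morphism (@transform F k).
Proof.
split; elim: k => [|k IHk] //=.
  by rewrite /transform /= -!/(transform _ _) IHk rmorph1.
by move=> x y; rewrite /transform /= -!/(transform _ _) IHk rmorphM.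
Qed.

HB.instance Definition _ k :=
  GRing.isZmodMorphism.Build F F (@transform F k) (transform_zmod_morphism k).
HB.instance Definition _ k :=
  GRing.isMonoidMorphism.Build F F (@transform F k) (transform_monoid_morphism k).

Lemma transform_add k l (x : F) : transform k (transform l x) = transform (k + l) x.
Proof. by rewrite /transform iterD. Qed.

Lemma transformS k (x : F) : transform k.+1 x = shift F (transform k x).
Proof. by []. Qed.

End TransformMorphism.

Lemma emb_transform (F : diffField) (L : diffExt F) k (a : F) :
  emb L (transform k a) = transform k (emb L a).
Proof. by elim: k => // k IHk; rewrite !transformS emb_shift IHk. Qed.

(** The basis is recorded by indices rather than by elements, so that the same selection can be
    tried on another family. *)
Lemma rank_seq (I : eqType) (L : fieldType) (B : L -> Prop) (b : I -> L) (js : seq I) :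
  exists ks, [/\ subseq ks js, indep B (map b ks) &
    forall j, j \in js -> acl (setjoin B (inseq (map b ks))) (b j)].
Proof.
elim: js => [|j js [ks [ksjs Bks sp]]]; first by exists [::].
have [dj|nj] := lem (acl (setjoin B (inseq (map b ks))) (b j)).
  exists ks; split=> // [|i]; first exact: subseq_trans ksjs (subseq_cons _ _).
  by rewrite inE => /orP[/eqP->|/sp].
exists (j :: ks); split=> //= [|i]; first by rewrite eqxx.
rewrite inE => /orP[/eqP->|/sp]; first by apply: acl_in; right; apply: mem_head.
apply: acl_mono => z [|zs]; first by left.
by right; rewrite /inseq inE [z \in _]zs orbT.
Qed.

Section Transforms.
Context (F : diffField) (L : diffExt F).
Local Notation base := (base_set L).
Implicit Types (J : finType).

Definition orbit_fam J (eta : J -> L) (v : J * nat) : L := transform v.2 (eta v.1).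

(** The bound is strict, hence the transforms of order at most t are [orbit_below eta t.+1], and
    order bounds add without correction under [transform]. *)
Definition orbit_below J (eta : J -> L) (t : nat) : L -> Prop :=
  fun x => exists i k, (k < t)%N /\ x = transform k (eta i).

Definition orbit_index J (t : nat) : seq (J * nat) :=
  [seq (i, k) | i <- enum J, k <- iota 0 t].

Lemma mem_orbit_index J t (v : J * nat) : (v \in orbit_index J t) = (v.2 < t)%N.
Proof.
apply/allpairsP/idP => [[[i k] [_ kt ->]]|]; first by move: kt; rewrite mem_iota.
by case: v => i k kt; exists (i, k); rewrite mem_enum mem_iota.
Qed.

Lemma orbit_index_uniq J t : uniq (orbit_index J t).
Proof. by apply: allpairs_uniq => [||[? ?] [? ?]]; rewrite ?enum_uniq ?iota_uniq. Qed.

Lemma size_orbit_index J t : size (orbit_index J t) = (#|J| * t)%N.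
Proof. by rewrite size_allpairs -cardE size_iota. Qed.

Lemma orbit_belowP J (eta : J -> L) t x :
  orbit_below eta t x <-> inseq (map (orbit_fam eta) (orbit_index J t)) x.
Proof.
split=> [[i [k [kt ->]]]|/mapP[[i k] kt ->]].
  by apply/mapP; exists (i, k); rewrite ?mem_orbit_index.
by exists i, k; split=> //; rewrite mem_orbit_index in kt.
Qed.

Lemma acl_transform k (X : L -> Prop) x : acl (setjoin base X) x ->
  acl (setjoin base (image_set (transform k) X)) (transform k x).
Proof.
move=> /(acl_image (@transform L k)); apply: acl_mono => _ [y [[a ->]|Xy] ->].
  by left; exists (transform k a); rewrite emb_transform.
by right; exists y.
Qed.

Lemma orbit_belowS J (eta : J -> L) t u x : (t <= u)%N ->
  orbit_below eta t x -> orbit_below eta u x.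
Proof.
by move=> tu [i [k [kt ->]]]; exists i, k; split=> //; apply: leq_trans tu.
Qed.

Lemma image_orbit_below J (eta : J -> L) t k x :
  image_set (transform k) (orbit_below eta t) x -> orbit_below eta (k + t) x.
Proof.
by move=> [_ [i [l [lt ->]]] ->]; exists i, (k + l)%N; rewrite ltn_add2l transform_add.
Qed.

Lemma acl_transform_orbit J (eta : J -> L) t k x :
  acl (setjoin base (orbit_below eta t)) x ->
  acl (setjoin base (orbit_below eta (k + t))) (transform k x).
Proof.
move=> /(acl_transform k); apply: acl_mono => y [|]; first by left.
by move/image_orbit_below; right.
Qed.

Lemma acl_orbitS J (eta : J -> L) t u x : (t <= u)%N ->
  acl (setjoin base (orbit_below eta t)) x -> acl (setjoin base (orbit_below eta u)) x.
Proof.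
move=> tu; apply: acl_mono => y [|]; first by left.
by move/(orbit_belowS tu); right.
Qed.

Lemma gen_diff_field_acl J (eta : J -> L) z :
  gen_diff_field (fun x => exists i, x = eta i) z ->
  exists t, acl (setjoin base (orbit_below eta t)) z.
Proof.
move=> /(_ (fun z => exists t, acl (setjoin base (orbit_below eta t)) z)).
apply; last first.
  by move=> _ [i ->]; exists 1%N; apply: acl_in; right; exists i, 0%N.
have max2 t u x y : acl (setjoin base (orbit_below eta t)) x ->
    acl (setjoin base (orbit_below eta u)) y ->
    fgen (acl (setjoin base (orbit_below eta (maxn t u)))) x /\
    fgen (acl (setjoin base (orbit_below eta (maxn t u)))) y.
  by move=> tx uy; split; apply: fgen_in; [apply: acl_orbitS tx | apply: acl_orbitS uy];
    rewrite ?leq_maxl ?leq_maxr.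
split=> [|x [t tx]]; last by exists (1 + t)%N; apply: (acl_transform_orbit 1).
split=> [a|x y [t tx] [u uy]|x y [t tx] [u uy]|x [t tx]].
- by exists 0%N; apply: acl_in; left; exists a.
- have [x' y'] := max2 _ _ _ _ tx uy.
  by exists (maxn t u); apply: acl_closed; apply: fgenB.
- have [x' y'] := max2 _ _ _ _ tx uy.
  by exists (maxn t u); apply: acl_closed; apply: fgenM.
- by exists t; apply: acl_closed; apply: fgenV; apply: fgen_in.
Qed.

Lemma gen_diff_field_in (X : L -> Prop) x : X x -> gen_diff_field X x.
Proof. by move=> Xx S _; apply. Qed.

Lemma orbit_rank_index J (eta : J -> L) t m : has_rank base (orbit_below eta t) m ->
  exists ks, [/\ uniq ks, {subset ks <= orbit_index J t}, size ks = m,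
    indep base (map (orbit_fam eta) ks) & forall v, (v.2 < t)%N ->
      acl (setjoin base (inseq (map (orbit_fam eta) ks))) (orbit_fam eta v)].
Proof.
move=> rm; have [ks [sks Bks sp]] := rank_seq base (orbit_fam eta) (orbit_index J t).
have rk : has_rank base (orbit_below eta t) (size ks).
  exists (map (orbit_fam eta) ks); rewrite size_map; split=> // x.
    case/mapP=> v /(mem_subseq sks) vt ->; apply/orbit_belowP.
    exact: map_f.
  by move/orbit_belowP/mapP => [v /sp vt ->].
exists ks; split=> //.
- exact: subseq_uniq sks (orbit_index_uniq _ _).
- exact: mem_subseq.
- by apply: has_rank_uniq rk rm => // x xP; apply: acl_in => //; right.
- by move=> v vt; apply: sp; rewrite mem_orbit_index.
Qed.

Lemma orbit_rank_exists J (eta : J -> L) t : exists m, has_rank base (orbit_below eta t) m.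
Proof.
have [ks [sks Bks sp]] := rank_seq base (orbit_fam eta) (orbit_index J t).
exists (size ks), (map (orbit_fam eta) ks); rewrite size_map; split=> // x.
  by case/mapP=> v /(mem_subseq sks) vt ->; apply/orbit_belowP; apply: map_f.
by move/orbit_belowP/mapP => [v /sp vt ->].
Qed.

Lemma trunc_field_rank n (eta : 'I_n -> L) t m :
  has_trdeg (trunc_field eta t) m <-> has_rank base (orbit_below eta t.+1) m.
Proof.
have tr_acl x : trunc_field eta t x -> acl (setjoin base (orbit_below eta t.+1)) x.
  move=> /(_ (fun z => acl (setjoin base (orbit_below eta t.+1)) z)).
  apply; last by move=> _ [i [k [kt ->]]]; apply: acl_in; right; exists i, k.
  split=> [a|x1 y x1P yP|x1 y x1P yP|x1 x1P].
  - by apply: acl_in; left; exists a.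
  - by apply: acl_closed; apply: fgenB; apply: fgen_in.
  - by apply: acl_closed; apply: fgenM; apply: fgen_in.
  - by apply: acl_closed; apply: fgenV; apply: fgen_in.
have acl_tr x : orbit_below eta t.+1 x -> trunc_field eta t x.
  by move=> [i [k [kt ->]]] S _; apply; exists i, k.
rewrite has_trdegP; split=> rm; last first.
  have [s [sm sX sI ss]] := rm; exists s; split=> // [x /sX/acl_tr//|x /tr_acl].
  by apply: acl_trans => y [yb|/ss//]; apply: acl_in; left.
have [m' rm'] := orbit_rank_exists eta t.+1.
suff -> : m = m' by [].
apply: has_rank_uniq rm rm' => x; [exact: acl_in | exact: acl_in | exact: tr_acl |].
by move=> /acl_tr xt; apply: acl_in; right.
Qed.

(** The [T] first transforms of each [b i] are independent and stay within [T + t] orders of [eta];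
    this bounds the growth of the rank from below. *)
Lemma transf_indep_rank_leq J J' (b : J -> L) (eta : J' -> L) t T m :
  transf_indep b -> (forall i, acl (setjoin base (orbit_below eta t)) (b i)) ->
  has_rank base (orbit_below eta (T + t)) m -> (#|J| * T <= m)%N.
Proof.
move=> /alg_indepP bI bt rm; rewrite -size_orbit_index -(size_map (orbit_fam b)).
apply: has_rank_leq rm _ _; first exact/bI/orbit_index_uniq.
move=> _ /mapP[[i k] kT ->]; rewrite mem_orbit_index /= in kT.
apply: acl_orbitS (acl_transform_orbit k (bt i)).
by rewrite leq_add2r ltnW.
Qed.

Lemma transf_indep_inj (I1 I2 : finType) (f : I1 -> I2) (b : I2 -> L) :
  injective f -> transf_indep b -> transf_indep (b \o f).
Proof.
move=> f_inj /alg_indepP bI; apply/alg_indepP => s us.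
pose g (v : I1 * nat) := (f v.1, v.2).
have g_inj : injective g by move=> [i k] [j l] [/f_inj-> ->].
have := bI (map g s); rewrite map_inj_uniq // => /(_ us).
by rewrite -map_comp.
Qed.

Definition ext_fam J (b : J -> L) (x : L) (o : option J) : L :=
  if o is Some i then b i else x.

Definition orbit1 (x : L) (T : nat) : L -> Prop :=
  fun z => exists2 k, (k < T)%N & z = transform k x.

(** Transformal dependence of [x] on [b] can be solved for a highest transform of [x]. *)
Lemma transf_dependent J (b : J -> L) x : transf_indep b ->
  ~ transf_indep (ext_fam b x) -> exists T N,
  acl (setjoin base (setjoin (orbit_below b N) (orbit1 x T))) (transform T x).
Proof.
move=> /alg_indepP bI nx; apply: contrapT => nTN; apply: nx; apply/alg_indepP => s us.
pose N := (\max_(v <- s) v.2.+1)%N.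
pose lo := [seq (Some v.1, v.2) | v <- orbit_index J N].
pose hi T : seq (option J * nat) := [seq (None, k) | k <- rev (iota 0 T)].
have lo_uniq : uniq lo.
  by rewrite map_inj_uniq ?orbit_index_uniq // => -[? ?] [? ?] [-> ->].
have hi_uniq : uniq (hi N).
  by rewrite map_inj_uniq ?rev_uniq ?iota_uniq // => ? ? [].
pose fam v := transform v.2 (ext_fam b x v.1).
have loE : map fam lo = map (orbit_fam b) (orbit_index J N).
  by rewrite -map_comp.
apply: (indep_perm (t := hi N ++ lo)) => //.
- rewrite cat_uniq lo_uniq hi_uniq andbT; apply/hasPn => _ /mapP[v _ ->].
  by apply/mapP => -[].
- move=> [o k] sok; have kN : (k < N)%N by exact: (leq_bigmax_seq (F := fun v => v.2.+1) _ sok).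
  rewrite mem_cat; case: o sok => [i|] _; apply/orP; [right | left].
    by apply/mapP; exists (i, k); rewrite ?mem_orbit_index.
  by apply/mapP; exists k; rewrite // mem_rev mem_iota.
rewrite map_cat; apply/indep_cat; split; first by rewrite loE; apply/bI/orbit_index_uniq.
(* The transforms of [x] are adjoined in increasing order above those of [b]; a failure at stage [T]
   is exactly the dependence excluded by [nTN]. *)
elim: (N in hi N) => //= T IHT; rewrite /hi -addn1 iotaD rev_cat /= add0n; split=> // dT.
apply: nTN; exists T, N; apply: acl_mono dT => z [[|]|]; first by left.
  by rewrite -/fam loE => /orbit_belowP zN; right; left.
move=> /mapP[_ /mapP[k kT ->] ->]; right; right; exists k => //.
by move: kT; rewrite mem_rev mem_iota.
Qed.

(** Transforming the relation reaches every later transform of [x], at the price of raising the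
    orders of [b]; lower transforms of [x] are removed by strong induction on [k]. *)
Lemma transf_dependent_all J (b : J -> L) x T N :
  acl (setjoin base (setjoin (orbit_below b N) (orbit1 x T))) (transform T x) ->
  forall k, acl (setjoin base (setjoin (orbit_below b (N + k)) (orbit1 x T))) (transform k x).
Proof.
move=> xT k; have [m] := ubnP k; elim: m k => // m IHm k ltkm.
have [kT|Tk] := ltnP k T; first by apply: acl_in; right; right; exists k.
have := acl_transform (k - T) xT; rewrite transform_add subnK //.
apply: acl_trans => z [|[y [yN|[l lT ->]] ->]]; first by move=> zb; apply: acl_in; left.
  apply: acl_in; right; left.
  apply: (@orbit_belowS _ _ (k - T + N)); first by rewrite addnC leq_add2l leq_subr.
  by apply: image_orbit_below; exists y.
rewrite transform_add; have lk : (k - T + l < k)%N.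
  by rewrite -ltn_subRL subKn.
have lm : (k - T + l < m)%N by apply: leq_trans lk _; rewrite -ltnS.
apply: acl_mono (IHm _ lm) => w [|[wN|wx]]; [by left| |by right; right].
by right; left; apply: orbit_belowS wN; rewrite leq_add2l ltnW.
Qed.

(** Each coordinate of [eta] contributes only boundedly many transforms beyond the orbit of [b], so
    the slope of the rank is at most the cardinality of [b]. *)
Lemma dependent_rank_leq J J' (b : J -> L) (eta : J' -> L) : transf_indep b ->
  (forall j, ~ transf_indep (ext_fam b (eta j))) ->
  exists N C, forall t m, has_rank base (orbit_below eta t) m ->
    (m <= #|J| * (N + t) + C)%N.
Proof.
move=> bI bmax; have /choice[w wP] : forall j, exists w : nat * nat,
    acl (setjoin base (setjoin (orbit_below b w.2) (orbit1 (eta j) w.1)))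
        (transform w.1 (eta j)).
  by move=> j; have [T [N TN]] := transf_dependent bI (bmax j); exists (T, N).
pose N := (\max_j (w j).2)%N; pose T := (\max_j (w j).1)%N.
exists N, (#|J'| * T)%N => t m rm.
pose s := map (orbit_fam b) (orbit_index J (N + t)) ++
          map (orbit_fam eta) (orbit_index J' T).
have <- : size s = (#|J| * (N + t) + #|J'| * T)%N.
  by rewrite size_cat !size_map !size_orbit_index.
apply: has_rank_geq rm _ => _ [j [k [kt ->]]].
apply: acl_mono (transf_dependent_all (wP j) k) => z [|[zN|[l lT ->]]]; first by left.
  right; rewrite /inseq mem_cat; apply/orP; left; apply/orbit_belowP.
  apply: orbit_belowS zN; apply: leq_add; last exact: ltnW.
  exact: (leq_bigmax (F := fun j => (w j).2)).
right; rewrite /inseq mem_cat; apply/orP; right; apply/orbit_belowP.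
exists j, l; split=> //; apply: leq_trans lT _.
exact: (leq_bigmax (F := fun j => (w j).1)).
Qed.

Lemma orbit_acl_bound J J' (b : J -> L) (eta : J' -> L) :
  (forall i, exists t, acl (setjoin base (orbit_below eta t)) (b i)) ->
  exists t, forall i, acl (setjoin base (orbit_below eta t)) (b i).
Proof.
move=> /choice[w wP]; exists (\max_i w i)%N => i.
by apply: acl_orbitS (wP i); apply: leq_bigmax.
Qed.

End Transforms.

(** * Transformal transcendence degree as the growth rate of ranks *)

Section Growth.
Context (F : diffField) (L : diffExt F) (n : nat) (eta : 'I_n -> L).

(** A transformal transcendence basis lies in the closure of a finite stage of the orbit, which
    gives the lower bound; each [eta j] depends on it, which gives the upper one. *)
Lemma transf_trdeg_rank (d : nat) :
  has_transf_trdeg (gen_diff_field (fun x => exists i, x = eta i)) d ->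
  exists t1 C, forall t m, has_rank (base_set L) (orbit_below eta t) m ->
    (d * t <= m + t1)%N /\ (m <= d * t + C)%N.
Proof.
move=> [b [Eb bI bmax]].
have [t1 bt1] := orbit_acl_bound (fun i => gen_diff_field_acl (Eb i)).
have bmax' j : ~ transf_indep (ext_fam b (eta j)).
  by apply: bmax; apply: gen_diff_field_in; exists j.
have [N [C NC]] := dependent_rank_leq bI bmax'.
exists (d * t1)%N, (d * N + C)%N => t m rm; rewrite card_ord in NC; split; last first.
  by apply: leq_trans (NC t m rm) _; rewrite mulnDr addnCA addnA.
have [t_le|/ltnW t_ge] := leqP t t1.
  by apply: leq_trans (leq_addl _ _); rewrite leq_mul2l t_le orbT.
rewrite -{1}(subnK t_ge) mulnDr leq_add2r.
have := @transf_indep_rank_leq _ _ _ _ b eta t1 (t - t1) m bI bt1.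
by rewrite subnK // card_ord; apply.
Qed.

Lemma leq_of_linear_growth (a b c t0 : nat) :
  (forall t, (t0 <= t)%N -> (a * t <= b * t + c)%N) -> (a <= b)%N.
Proof.
move=> growth; rewrite leqNgt; apply/negP => ba.
have := growth (t0 + c.+1)%N (leq_addr _ _).
rewrite -(subnK ba) mulnDl leqNgt; case/negP.
apply: leq_trans (leq_addl _ _); rewrite mulSn [(_ + b * _)%N]addnC ltn_add2l.
by rewrite addnS ltnS leq_addl.
Qed.

(** The slope [d] bounds every transformally independent family of F<eta>, while a maximal
    independent set of [e] coordinates bounds the slope by [e]. Hence e = d, and no extension by an
    element of F<eta> can be independent. *)
Lemma rank_transf_trdeg (d c t0 : nat) :
  (forall t, (t0 <= t)%N -> has_rank (base_set L) (orbit_below eta t.+1) (d * t.+1 + c)) ->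
  has_transf_trdeg (gen_diff_field (fun x => exists i, x = eta i)) d.
Proof.
move=> rk; have card_leq (J : finType) (b : J -> L) : transf_indep b ->
    (forall i, gen_diff_field (fun x => exists i, x = eta i) (b i)) -> (#|J| <= d)%N.
  move=> bI Eb; have [t1 bt1] := orbit_acl_bound (fun i => gen_diff_field_acl (Eb i)).
  apply: (@leq_of_linear_growth _ _ (d * t1 + c) t0.+1) => t t0t.
  rewrite addnA -mulnDr; apply: transf_indep_rank_leq bI bt1 _.
  case: t t0t => // t t0t; rewrite addSn; apply: rk.
  by rewrite ltnS in t0t; apply: leq_trans t0t (leq_addr _ _).
pose P e := `[< exists (J : finType) (b : J -> 'I_n),
  #|J| = e /\ transf_indep (eta \o b) >].
have P0 : exists e, P e.
  exists 0%N; apply/asboolP; exists void, (fun i : void => match i with end).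
  by rewrite card_void; split=> //; apply/alg_indepP => -[|[[]]].
have eta_in i : gen_diff_field (fun x => exists i, x = eta i) (eta i).
  by apply: gen_diff_field_in; exists i.
have Pd e : P e -> (e <= d)%N.
  by move=> /asboolP[J [b [<- bI]]]; apply: card_leq bI _ => i; apply: eta_in.
have [e /asboolP[J [b [Je bI]]] emax] := ex_maxnP P0 Pd.
have bmax j : ~ transf_indep (ext_fam (eta \o b) (eta j)).
  move=> bjI; suff /emax : P e.+1 by rewrite ltnn.
  apply/asboolP; exists (option J), (fun o => if o is Some i then b i else j).
  rewrite card_option Je; split=> //.
  by rewrite (_ : eta \o _ = ext_fam (eta \o b) (eta j)) //; apply/funext; case.
have [N [C NC]] := dependent_rank_leq bI bmax.
have ed : e = d.
  apply/eqP; rewrite eqn_leq -{1}Je (card_leq _ _ bI) => [|i]; last exact: eta_in.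
  apply: (@leq_of_linear_growth _ _ (e * N + C) t0.+1) => -[//|t] t0t.
  rewrite addnA -mulnDr [(t.+1 + N)%N]addnC -Je.
  by apply: leq_trans (NC _ _ (rk t t0t)); apply: leq_addr.
rewrite -ed -Je; exists (eta \o b \o enum_val); split=> [i||x Ex].
- exact: eta_in.
- exact: transf_indep_inj enum_val_inj bI.
- move=> xI; suff : (#|{: option 'I_#|J|}| <= d)%N.
    by rewrite card_option card_ord Je ed ltnn.
  by apply: card_leq xI _ => -[i|//]; apply: eta_in.
Qed.

End Growth.

(** The polynomial relations among the transforms of a generic zero are exactly the members of [J],
    so the same indices select a basis at either zero. *)
Lemma generic_zero_rank (F : diffField) (n : nat) (J : {dpoly F[n]} -> Prop)
    (L L' : diffExt F) (eta : 'I_n -> L) (eta' : 'I_n -> L') t m :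
  is_generic_zero J eta -> is_generic_zero J eta' ->
  has_rank (base_set L) (orbit_below eta t) m ->
  has_rank (base_set L') (orbit_below eta' t) m.
Proof.
move=> zJ zJ' /orbit_rank_index[ks [uks kst <- Iks sp]].
have swap (l : seq ('I_n * nat)) : uniq l -> indep (base_set L) (map (orbit_fam eta) l) <->
    indep (base_set L') (map (orbit_fam eta') l).
  move=> ul; split=> /indep_onP-/(_ ul) lI; apply/indep_onP => // p lp p0; apply: lI => //.
    by apply/zJ/zJ'.
  by apply/zJ'/zJ.
have /(swap _ uks) Iks' := Iks.
exists (map (orbit_fam eta') ks); rewrite size_map; split=> // [x|x].
  by case/mapP=> v /kst vt ->; apply/orbit_belowP; apply: map_f.
move=> /orbit_belowP/mapP[v]; rewrite mem_orbit_index => /sp vsp ->.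
have [vks|vks] := boolP (v \in ks); first by apply: acl_in; right; apply: map_f.
apply: contrapT => nv; suff /(swap (v :: ks)) :
    indep (base_set L') (map (orbit_fam eta') (v :: ks)).
  by rewrite /= vks uks => /(_ isT) [].
by [].
Qed.

(** The generic zeros behind dimension and order may differ, and so may the two slopes; comparing
    linear growth at a common zero identifies the slopes. *)
Lemma dim_ord_rank (F : diffField) (n : nat) (J : {dpoly F[n]} -> Prop) (d h : nat) :
  has_dim J d -> has_ord J h ->
  exists (L : diffExt F) (eta : 'I_n -> L), is_generic_zero J eta /\
  exists t0, forall t, (t0 <= t)%N ->
    has_rank (base_set L) (orbit_below eta t.+1) (d * t.+1 + h).
Proof.
move=> [L1 [eta1 [z1 dim1]]] [d' [_ [L [eta [z [t0 rk]]]]]].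
have {}rk t : (t0 <= t)%N ->
    has_rank (base_set L) (orbit_below eta t.+1) (d' * t.+1 + h).
  by move=> /rk/trunc_field_rank.
have [t1 [C dC]] := transf_trdeg_rank dim1.
have {}dC t : (t0 <= t)%N -> (d * t.+1 <= d' * t.+1 + h + t1)%N /\
    (d' * t.+1 + h <= d * t.+1 + C)%N.
  by move=> /rk /(generic_zero_rank z z1)/dC.
suff -> : d = d' by exists L, eta; split=> //; exists t0.
apply/eqP; rewrite eqn_leq; apply/andP; split.
  apply: (@leq_of_linear_growth _ _ (h + t1) t0.+1) => -[//|t] /dC[].
  by rewrite addnA.
apply: (@leq_of_linear_growth _ _ C t0.+1) => -[//|t] /dC[_].
by apply: leq_trans; apply: leq_addr.
Qed.

Lemma eq_peval (R S : comNzRingType) (I : choiceType) (f g : {rmorphism R -> S})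
  (v w : I -> S) : f =1 g -> v =1 w -> peval f v =1 peval g w.
Proof.
move=> fg vw; apply: (malg_rmorph_eq (f := peval f v) (g := peval g w)) => [c|i] /=.
  by rewrite !pevalC.
by rewrite !pevalX.
Qed.

Lemma mcoeff_peval (R S : comNzRingType) (I : choiceType) (f : {rmorphism R -> S})
    (p : {malg R[{cmonom I}]}) (m : {cmonom I}) :
  (peval (malgC \o f) (@pvar S I) p)@_m = f p@_m.
Proof.
have mon (k : {cmonom I}) :
    \prod_(i <- finsupp (cmonom_val k)) pvar S i ^+ k i = << k >>.
  by rewrite -[RHS]peval_id peval_monom.
rewrite pevalE raddf_sum /=.
rewrite (eq_bigr (fun k => f p@_k *+ (k == m))) => [|k _]; last first.
  by rewrite mon mcoeffCM mcoeffU1 mulr_natr.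
have [mp|mp] := boolP (m \in msupp p).
  rewrite (big_rem m) //= eqxx big1_seq ?addr0 // => k /andP[_].
  by rewrite mem_rem_uniq ?fset_uniq // inE => /andP[/negPf->].
rewrite big1_seq ?mcoeff_outdom ?raddf0 // => k /andP[_ kp].
by case: eqP kp mp => // -> ->.
Qed.

(** The shift raises the index of each variable and acts on the coefficients. It extends from
    polynomials to fractions once its kernel is known to be zero. *)
Lemma free_diff_ext (L : diffField) (V : choiceType) :
  exists (M : diffExt L) (v : V -> M),
    transf_indep v /\
    (forall z, exists p q, peval (emb M) (fun w => transform w.2 (v w.1)) q != 0 /\
       z = peval (emb M) (fun w => transform w.2 (v w.1)) p /
           peval (emb M) (fun w => transform w.2 (v w.1)) q).
Proof.
have [M [iota [w [w_inj fracM]]]] := free_field L (V * nat)%type.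
pose next (x : V * nat) := (x.1, x.2.+1); pose prev (x : V * nat) := (x.1, x.2.-1).
have nextK p : peval (iota \o shift L) (w \o next) p = 0 -> p = 0.
  pose T := peval (malgC \o shift L) (@pvar L _ \o next).
  have fT : peval (iota \o shift L) (w \o next) =1 peval iota w \o T.
    apply: (malg_rmorph_eq (f := peval (iota \o shift L) (w \o next))
      (g := peval iota w \o T)) => [c|i] /=; first by rewrite /T !pevalC /= ?pevalC.
    by rewrite /T !pevalX /= ?pevalX.
  rewrite fT => /w_inj Tp0.
  (* Lowering the indices again leaves the coefficientwise shift. This is injective, although the
     shift of [L] need not be invertible. *)
  pose U := peval malgC (@pvar L _ \o prev).
  have UT : U \o T =1 peval (malgC \o shift L) (@pvar L _).
    apply: (malg_rmorph_eq (f := U \o T) (g := peval (malgC \o shift L) (@pvar L _))).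
      move=> c; rewrite -[LHS]/(U (T (malgC c))).
      have -> : T (malgC c) = malgC (shift L c) by exact: pevalC.
      by rewrite /U pevalC; symmetry; exact: pevalC.
    move=> [i k]; rewrite -[LHS]/(U (T (pvar L (i, k)))).
    have -> : T (pvar L (i, k)) = pvar L (i, k.+1) by exact: pevalX.
    by rewrite /U pevalX; symmetry; exact: pevalX.
  apply/malgP => m; apply/eqP; rewrite mcoeff0 -(fmorph_eq0 (shift L)).
  rewrite -mcoeff_peval -UT /= Tp0; have -> : U 0 = 0 by exact: rmorph0.
  by rewrite mcoeff0.
have [sigma sigmaE] : exists sigma : {rmorphism M -> M}, forall p,
    sigma (peval iota w p) = peval (iota \o shift L) (w \o next) p.
  apply: fraction_rmorphism fracM => p; split=> [/w_inj->|/nextK->]; exact: raddf0.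
have iota_shift a : iota (shift L a) = sigma (iota a).
  by have := sigmaE (malgC a); rewrite !pevalC /=.
have sigma_w x : sigma (w x) = w (next x).
  by have := sigmaE (pvar L x); rewrite !pevalX.
pose D := @DiffExt L (@DiffField M sigma) iota iota_shift.
have wE : (fun x : V * nat => transform x.2 (w (x.1, 0%N) : D)) = w.
  apply/funext => -[i k] /=; elim: k => // k IHk.
  by rewrite transformS /= IHk; apply: sigma_w.
exists D, (fun i => w (i, 0%N)); rewrite wE; split=> // p.
by rewrite wE => /w_inj.
Qed.

Section Disjointness.
Context (L : fieldType).

(** Elements free over a larger closed set cannot help to make one of its members algebraic over a
    smaller base. *)
Lemma acl_disjoint (B C Z : L -> Prop) x :
  (forall y, B y -> acl C y) -> acl C x ->
  (forall s : seq L, (forall y, y \in s -> Z y) ->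
     exists2 t : seq L, {subset s <= t} & indep C t) ->
  acl (setjoin B Z) x -> acl B x.
Proof.
move=> BC Cx ZI /acl_finite[l lBZ lx].
pose s := [seq y <- l | `[< Z y >]].
have [|t st Ct] := ZI s.
  by move=> y; rewrite mem_filter => /andP[/asboolP].
apply: contrapT => nx.
(* Were [x] transcendental over [B], this independent list would lie in the closure of [t], which
   has one entry fewer. *)
have tx : indep B (t ++ [:: x]).
  apply/indep_cat; split; first by split=> // Bx; apply: nx; apply: acl_mono Bx => y [].
  apply: indep_mono Ct => y [/BC//|]; by rewrite /inseq inE => /eqP->.
have /(indep_leq_size tx) : forall y, y \in t ++ [:: x] -> acl (setjoin B (inseq t)) y.
  move=> y; rewrite mem_cat => /orP[ty|]; first by apply: acl_in; right.
  rewrite inE => /eqP->; apply: acl_mono lx => z lz.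
  have [Bz|nBz] := lem (B z); [by left | right].
  apply: st; rewrite mem_filter [z \in l]lz andbT; apply/asboolP.
  by case: (lBZ z lz).
by rewrite size_cat /= addn1 ltnn.
Qed.

End Disjointness.

(** * Difference polynomials, their transforms and difference ideals *)

HB.instance Definition _ (F : diffField) n :=
  GRing.RMorphism.copy (@ptransform F n)
    (peval (malgC \o shift F) (fun v => pvar F (v.1, v.2.+1))).
HB.instance Definition _ (F : diffField) n (L : diffExt F) (eta : 'I_n -> L) :=
  GRing.RMorphism.copy (deval eta)
    (peval (emb L) (fun v => transform v.2 (eta v.1))).
HB.instance Definition _ (F : diffField) n (L : diffExt F) :=
  GRing.RMorphism.copy (@dmap F n L)
    (peval (malgC \o emb L) (fun v => pvar L v)).

Section DiffPolyMorphisms.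
Context (F : diffField) (n : nat).

Lemma ptransformC (c : F) : ptransform (malgC c : {dpoly F[n]}) = malgC (shift F c).
Proof. exact: pevalC. Qed.

Lemma ptransformX (w : 'I_n * nat) : ptransform (pvar F w) = pvar F (w.1, w.2.+1).
Proof. exact: pevalX. Qed.

Lemma devalC (L : diffExt F) (eta : 'I_n -> L) c : deval eta (malgC c) = emb L c.
Proof. exact: pevalC. Qed.

Lemma devalX (L : diffExt F) (eta : 'I_n -> L) w :
  deval eta (pvar F w) = transform w.2 (eta w.1).
Proof. exact: pevalX. Qed.

Lemma dmapC (L : diffExt F) c : dmap (n := n) L (malgC c) = malgC (emb L c).
Proof. exact: pevalC. Qed.

Lemma dmapX (L : diffExt F) (w : 'I_n * nat) : dmap L (pvar F w) = pvar L w.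
Proof. exact: pevalX. Qed.

End DiffPolyMorphisms.

Section DiffPolyTransforms.
Context (F : diffField) (n : nat).

Lemma deval_ptransform (L : diffExt F) (eta : 'I_n -> L) p :
  deval eta (ptransform p) = shift L (deval eta p).
Proof.
apply: (malg_rmorph_eq (f := deval eta \o @ptransform F n)
  (g := shift L \o deval eta)) p => [c|w] /=.
  rewrite ptransformC [LHS]devalC emb_shift; congr (shift L _).
  by symmetry; exact: devalC.
rewrite ptransformX [LHS]devalX transformS; congr (shift L _).
by symmetry; exact: devalX.
Qed.

Lemma dmap_ptransform (L : diffExt F) (p : {dpoly F[n]}) :
  dmap L (ptransform p) = ptransform (dmap L p).
Proof.
apply: (malg_rmorph_eq (f := @dmap F n L \o @ptransform F n)
  (g := @ptransform L n \o @dmap F n L)) p => [c|w] /=.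
  rewrite [ptransform _]ptransformC [LHS]dmapC emb_shift -ptransformC; congr ptransform.
  by symmetry; exact: dmapC.
rewrite [ptransform _]ptransformX [LHS]dmapX -[LHS]ptransformX; congr ptransform.
by symmetry; exact: dmapX.
Qed.

Fact iter_ptransform_zmod_morphism k : zmod_morphism (iter k (@ptransform F n)).
Proof. by move=> p q; elim: k => // k IHk; rewrite !iterS IHk; exact: rmorphB. Qed.

Fact iter_ptransform_monoid_morphism k : monoid_morphism (iter k (@ptransform F n)).
Proof.
split; first by elim: k => // k IHk; rewrite iterS IHk; exact: rmorph1.
move=> p q; elim: k => [|k IHk]; first exact: erefl.
by rewrite -[LHS]/(ptransform (iter k _ (p * q))) IHk; exact: rmorphM.
Qed.

HB.instance Definition _ k := GRing.isZmodMorphism.Build {dpoly F[n]} {dpoly F[n]}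
  (iter k (@ptransform F n)) (iter_ptransform_zmod_morphism k).
HB.instance Definition _ k := GRing.isMonoidMorphism.Build {dpoly F[n]} {dpoly F[n]}
  (iter k (@ptransform F n)) (iter_ptransform_monoid_morphism k).

Lemma iter_ptransformC k (c : F) :
  iter k (@ptransform F n) (malgC c) = malgC (transform k c).
Proof.
elim: k => [|k IHk]; first exact: erefl.
by rewrite iterS IHk; exact: ptransformC.
Qed.

Lemma dmap_iter_ptransform (L : diffExt F) k (p : {dpoly F[n]}) :
  dmap L (iter k (@ptransform F n) p) = iter k (@ptransform L n) (dmap L p).
Proof.
elim: k => [|k IHk]; first exact: erefl.
by rewrite iterS dmap_ptransform IHk.
Qed.

Lemma dmap_dmonom_poly (L : diffExt F) s r (m : dmonom n s r) :
  dmap L (dmonom_poly F m) = dmonom_poly L m.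
Proof.
rewrite /dmonom_poly rmorph_prod; apply: eq_bigr => w _.
apply: etrans (rmorphXn _ _ _) _; apply: (congr1 (fun x => x ^+ _)).
exact: dmapX.
Qed.

Lemma generic_polyE s r (u : dmonom n s r -> F) :
  generic_poly u = \sum_m malgC (u m) * dmonom_poly F m.
Proof. by apply: eq_bigr => m _; exact: esym (mul_malgC _ _). Qed.

Lemma iter_ptransform_ideal (J : {dpoly F[n]} -> Prop) k p :
  is_diff_ideal J -> J p -> J (iter k (@ptransform F n) p).
Proof. by move=> [_ _ _ Jt] Jp; elim: k => //= k; apply: Jt. Qed.

Lemma gen_diff_ideal_is_ideal (X : {dpoly F[n]} -> Prop) :
  is_diff_ideal (gen_diff_ideal X).
Proof.
split=> [J [] //|p q Jp Jq J JI XJ|p q Jq J JI XJ|p Jp J JI XJ].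
- by have [_ JD _ _] := JI; apply: JD; [apply: Jp | apply: Jq].
- by have [_ _ JM _] := JI; apply: JM; apply: Jq.
- by have [_ _ _ Jt] := JI; apply: Jt; apply: Jp.
Qed.

(** Primality comes from values in a field, reflexivity from the injectivity of its shift. *)
Lemma vanishing_ideal (L : diffExt F) (eta : 'I_n -> L) :
  is_reflexive_prime_diff_ideal (fun p => deval eta p = 0).
Proof.
split; first split=> [|p q p0 q0|p q q0|p p0].
- exact: rmorph0.
- exact: etrans (rmorphD (deval eta) p q) (etrans (congr2 +%R p0 q0) (addr0 0)).
- exact: etrans (rmorphM (deval eta) p q) (etrans (congr1 ( *%R _) q0) (mulr0 _)).
- exact: etrans (deval_ptransform eta p) (etrans (congr1 _ p0) (rmorph0 _)).
- move=> p p0; apply/eqP; rewrite -(fmorph_eq0 (shift L)); apply/eqP.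
  exact: etrans (esym (deval_ptransform eta p)) p0.
- by move/(etrans (esym (rmorph1 (deval eta))))/eqP; rewrite oner_eq0.
- move=> p q /(etrans (esym (rmorphM (deval eta) p q)))/eqP.
  by rewrite mulf_eq0 => /orP[]/eqP; [left | right].
Qed.

Lemma is_reflexive_prime_diff_ideal_eq (J J' : {dpoly F[n]} -> Prop) :
  (forall p, J p <-> J' p) -> is_reflexive_prime_diff_ideal J ->
  is_reflexive_prime_diff_ideal J'.
Proof.
move=> JJ'; suff -> : J' = J by [].
by apply/funext => p; apply/propext; rewrite JJ'.
Qed.

End DiffPolyTransforms.

Section Monomials.
Context (n s r : nat).

Fact dmonom0_proof : (\sum_w [ffun _ : 'I_n * 'I_s.+1 => @ord0 r] w <= r)%N.
Proof. by rewrite big1 // => w _; rewrite ffunE. Qed.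

Let bounded (e : {ffun 'I_n * 'I_s.+1 -> 'I_r.+1}) : bool := (\sum_w e w <= r)%N.

Definition dmonom0 : dmonom n s r := exist bounded _ dmonom0_proof.

Lemma dmonom_poly0 (F : diffField) : dmonom_poly F dmonom0 = 1.
Proof. by rewrite /dmonom_poly big1 // => w _; rewrite /= ffunE expr0. Qed.

Fact dmonom_top_proof (r_gt0 : (0 < r)%N) (j : 'I_n) :
  (\sum_w [ffun w : 'I_n * 'I_s.+1 => inord (w == (j, ord_max)) : 'I_r.+1] w <= r)%N.
Proof.
rewrite (bigD1 (j, ord_max)) //= ffunE eqxx inordK ?ltnS // big1 ?addn0 // => w.
by rewrite ffunE => /negPf->; rewrite inordK.
Qed.

(** The monomial y_j^(s), available because [r > 0]; the translation of its coefficient reveals the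
    order [s] of the generic polynomial. *)
Definition dmonom_top r_gt0 (j : 'I_n) : dmonom n s r :=
  exist bounded _ (dmonom_top_proof r_gt0 j).

Lemma dmonom_poly_top (F : diffField) r_gt0 j :
  dmonom_poly F (dmonom_top r_gt0 j) = pvar F (j, s).
Proof.
have v1 : val (dmonom_top r_gt0 j) (j, ord_max) = 1%N :> nat.
  by rewrite /= ffunE eqxx inordK.
have v0 w : w != (j, ord_max) -> val (dmonom_top r_gt0 j) w = 0%N :> nat.
  by rewrite /= ffunE => /negPf->; rewrite inordK.
rewrite /dmonom_poly (bigD1 (j, ord_max)) //; apply: etrans (mulr1 _).
apply: (congr2 *%R); first by rewrite v1 expr1.
by apply: big1 => w /v0->; rewrite expr0.
Qed.

Lemma dmonom_top_neq0 r_gt0 j : dmonom_top r_gt0 j != dmonom0.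
Proof.
apply/eqP => /(congr1 val)/ffunP/(_ (j, ord_max))/(congr1 val) /=.
by rewrite !ffunE eqxx inordK ?ltnS.
Qed.

End Monomials.

Lemma peval_coef0 (A R S : comNzRingType) (V : choiceType)
    (f : {rmorphism R -> S}) (g : {rmorphism A -> R}) (w : V -> S) q :
  (forall p, peval f w p = 0 -> p = 0) -> peval (f \o g) w q = 0 ->
  forall m, g q@_m = 0.
Proof.
move=> w_inj q0 m; rewrite -mcoeff_peval (w_inj (peval (malgC \o g) (@pvar R V) q)).
  exact: mcoeff0.
rewrite -q0 rmorph_peval.
by apply: eq_peval => [a|i]; [exact: pevalC | exact: pevalX].
Qed.

(* The variables outside [A0] are eliminated with [tau] modulo [J]; a polynomial in
   the remaining ones vanishes only if its coefficients do. *)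
Lemma elimination_ideal (A B S : comNzRingType) (V : choiceType)
    (delta : {rmorphism A -> B}) (ev : {rmorphism B -> S}) (J : B -> Prop)
    (e : {rmorphism A -> S}) (c : V -> B) (w : V -> S) (A0 : V -> Prop)
    (tau : V -> {malg A[{cmonom V}]}) :
  J 0 -> (forall x y, J x -> J y -> J (x + y)) -> (forall x y, J y -> J (x * y)) ->
  (forall x, J x -> ev x = 0) ->
  (forall i, over A0 (tau i)) -> (forall i, J (c i - peval delta c (tau i))) ->
  (forall a, ev (delta a) = e a) -> (forall i, A0 i -> ev (c i) = w i) ->
  (forall a, e a = 0 -> J (delta a)) ->
  (forall q, peval e w q = 0 -> forall m, e q@_m = 0) ->
  forall q, ev (peval delta c q) = 0 -> J (peval delta c q).
Proof.
move=> J0 JD JM Jev tau0 Jtau eE wE Jdelta ind q q0.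
pose T := peval malgC tau.
have Tover p : over A0 (T p).
  elim/malg_ind: p => [a|i|p p' Tp Tp'|p p' Tp Tp'].
  - by rewrite /T pevalC; apply: overC.
  - by rewrite /T pevalX; apply: tau0.
  - by rewrite /T pevalD; exact (overD Tp Tp').
  - by rewrite /T pevalM; exact (overM Tp Tp').
have mulJ x y x' y' : J (x - y) -> J (x' - y') -> J (x * x' - y * y').
  move=> Jx Jx'; have -> : x * x' - y * y' = x' * (x - y) + y * (x' - y').
    by rewrite !mulrBr addrA [y * x']mulrC subrK mulrC.
  exact (JD _ _ (JM _ _ Jx) (JM _ _ Jx')).
have JT p : J (peval delta c p - peval delta c (T p)).
  elim/malg_ind: p => [a|i|p p' Jp Jp'|p p' Jp Jp'].
  - by rewrite /T !pevalC subrr.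
  - by rewrite /T !pevalX.
  - rewrite /T !pevalD opprD addrACA; exact (JD _ _ Jp Jp').
  - have e1 : peval delta c (p * p') = peval delta c p * peval delta c p'.
      exact: pevalM.
    have e2 : peval delta c (T (p * p')) = peval delta c (T p) * peval delta c (T p').
      exact: etrans (congr1 _ (pevalM malgC tau p p')) (pevalM _ _ _ _).
    exact: eq_ind _ J (mulJ _ _ _ _ Jp Jp') _ (esym (congr2 (fun a b => a - b) e1 e2)).
have Tq0 : ev (peval delta c (T q)) = 0.
  by have /eqP := Jev _ (JT q); rewrite rmorphB q0 sub0r oppr_eq0 => /eqP.
rewrite -(subrK (peval delta c (T q)) (peval delta c q)); apply: (JD) (JT q) _.
(* [T q] involves only variables of [A0], where [c] takes the values [w]; its vanishing therefore
   forces each coefficient into the kernel of [e], and so its image under [delta] into [J]. *)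
rewrite pevalE; elim/big_ind: _ => // m _; rewrite mulrC; apply: (JM).
apply/Jdelta/ind; rewrite -(eq_over_peval e wE (Tover q)) -Tq0 rmorph_peval.
by apply: eq_peval => [a|i] //=; rewrite eE.
Qed.

(** * A generic zero of the section *)

Section GenericExtension.
Context (F : diffField) (n s r : nat) (r_gt0 : (0 < r)%N).
Context (L : diffExt F) (eta : 'I_n -> L).
Context (M : diffExt L) (v : dmonom n s r -> M) (v_indep : transf_indep v).
Context (fracM : forall z, exists p q, peval (emb M) (orbit_fam v) q != 0 /\
  z = peval (emb M) (orbit_fam v) p / peval (emb M) (orbit_fam v) q).
Local Notation m0 := (dmonom0 n s r).

Fact comp_emb_shift (a : F) :
  (emb M \o emb L) (shift F a) = shift M ((emb M \o emb L) a).
Proof. by rewrite /= !emb_shift. Qed.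

Definition comp_ext : diffExt F := @DiffExt F M (emb M \o emb L) comp_emb_shift.
Local Notation MF := comp_ext.

Definition etaM (j : 'I_n) : MF := emb M (eta j).

Lemma transform_etaM k j : transform k (etaM j) = emb M (transform k (eta j)).
Proof. by rewrite emb_transform. Qed.

Lemma deval_etaM p : deval etaM p = emb M (deval eta p).
Proof.
rewrite /deval rmorph_peval; apply: (eq_peval (f := emb MF)) => [//|w].
exact: transform_etaM.
Qed.

Definition mval (m : dmonom n s r) : L := deval eta (dmonom_poly F m).

(* The coefficients of the generic polynomial through [eta]: all are free except the
   constant one, which is solved for. *)
Definition ustar (m : dmonom n s r) : MF :=
  if m == m0 then - \sum_(m' | m' != m0) v m' * emb M (mval m') else v m.

Definition free_coefs : MF -> Prop :=
  fun z => exists m k, m != m0 /\ z = transform k (v m).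

Lemma transform_ustar0 k : transform k (ustar m0) =
  - \sum_(m | m != m0) transform k (v m) * emb M (transform k (mval m)).
Proof.
rewrite /ustar eqxx rmorphN rmorph_sum; congr (- _); apply: eq_bigr => m _.
by rewrite rmorphM emb_transform.
Qed.

Lemma transform_ustar m k : m != m0 -> transform k (ustar m) = transform k (v m).
Proof. by rewrite /ustar => /negPf->. Qed.

Lemma free_coefs_finite (t : seq MF) : (forall y, y \in t -> free_coefs y) ->
  exists2 t' : seq MF, {subset t <= t'} & indep (rmorph_range (emb M)) t'.
Proof.
move=> tV; suff [N tN] : exists N, forall y, y \in t -> orbit_below v N y.
  exists (map (orbit_fam v) (orbit_index _ N)); last first.
    by move/alg_indepP: v_indep; apply; apply: orbit_index_uniq.
  by move=> y /tN/orbit_belowP.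
elim: t tV => [|y t IHt] tV; first by exists 0%N.
have [|N tN] := IHt; first by move=> z zt; apply: tV; rewrite inE zt orbT.
have [m [k [_ Dy]]] := tV y (mem_head _ _); exists (maxn N k.+1) => z.
rewrite inE => /orP[/eqP->|/tN]; last by apply: orbit_belowS; apply: leq_maxl.
by exists m, k; rewrite Dy; split=> //; apply: leq_maxr.
Qed.

Lemma acl_drop_free (B : MF -> Prop) x :
  (forall y, B y -> rmorph_range (emb M) y) -> rmorph_range (emb M) x ->
  acl (setjoin B free_coefs) x -> acl B x.
Proof.
move=> BM xM; apply: (acl_disjoint (C := rmorph_range (emb M))).
- by move=> y /BM; apply: acl_in.
- exact: acl_in.
- exact: free_coefs_finite.
Qed.

(** Adding 1 to one variable is an invertible substitution on polynomials, hence extends to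
    fractions. It moves a single transform of a single coefficient, so [alpha] is constructed as a
    field morphism and not as a difference one. *)
Lemma translate_coef m1 k1 : exists alpha : {rmorphism M -> M},
  (forall a, alpha (emb M a) = emb M a) /\
  (forall m k, alpha (transform k (v m)) =
     transform k (v m) + ((m, k) == (m1, k1))%:R).
Proof.
pose e (i : dmonom n s r * nat) : L := (i == (m1, k1))%:R.
pose tr (sg : L) : dmonom n s r * nat -> {malg L[{cmonom (dmonom n s r * nat)%type}]} :=
  fun i => pvar L i + malgC (sg * e i).
pose g := peval (emb M) (fun i => orbit_fam v i + emb M (e i)).
have gE p : g p = peval (emb M) (orbit_fam v) (peval malgC (tr 1) p).
  rewrite rmorph_peval; apply: eq_peval => [c|i]; symmetry; first exact: pevalC.
  apply: etrans (pevalD _ _ _ _) _; apply: congr2; first exact: pevalX.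
  by apply: etrans (pevalC _ _ _) _; rewrite mul1r.
have cancel i : malgC (-1 * e i) + malgC (1 * e i) =
    0 :> {malg L[{cmonom (dmonom n s r * nat)%type}]}.
  apply: etrans (esym (raddfD _ _ _)) _; rewrite mul1r mulN1r addNr.
  exact: raddf0.
have trK p : peval malgC (tr (-1)) (peval malgC (tr 1) p) = p.
  rewrite rmorph_peval -[RHS]peval_id; apply: eq_peval => [c|i]; first exact: pevalC.
  apply: etrans (pevalD _ _ _ _) _.
  apply: etrans (congr2 +%R (pevalX _ _ _) (pevalC _ _ _)) _.
  exact: etrans (esym (addrA _ _ _)) (etrans (congr1 (+%R _) (cancel i)) (addr0 _)).
have [alpha alphaE] : exists alpha : {rmorphism M -> M}, forall p,
    alpha (peval (emb M) (orbit_fam v) p) = g p.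
  apply: fraction_rmorphism fracM => p; split=> [/v_indep->|p0]; first exact: raddf0.
  have /v_indep p1 := etrans (esym (gE p)) p0.
  have -> : p = 0 := etrans (esym (trK p)) (etrans (congr1 _ p1) (raddf0 _)).
  exact: raddf0.
exists alpha; split=> [a|m k].
  by have := alphaE (malgC a); rewrite /g !pevalC.
have := alphaE (pvar L (m, k)); rewrite /g !pevalX => ->.
by rewrite /e rmorph_nat.
Qed.

(* Translating the coefficient of [y_j^(s)] by 1 changes [u_1] by [- eta_j^(s)]; so if
   [u_1^(k)] were algebraic, [eta_j^(k+s)] would be too. *)
Lemma transform_ustar0_transcendental k j :
  ~ acl (setjoin (base_set MF) (orbit_below etaM (k + s))) (transform (k + s) (etaM j)) ->
  ~ acl (setjoin (base_set MF) (setjoin free_coefs (orbit_below etaM (k + s))))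
      (transform k (ustar m0)).
Proof.
move=> trans wk; apply: trans.
pose m1 := dmonom_top s r_gt0 j; have m10 : m1 != m0 by apply: dmonom_top_neq0.
have [alpha [alphaM alphav]] := translate_coef m1 k.
set B := setjoin _ (setjoin _ _) in wk.
have embm1 : emb M (transform k (mval m1)) = transform (k + s) (etaM j).
  rewrite transform_etaM -transform_add /mval dmonom_poly_top; congr (emb M (transform k _)).
  exact: devalX.
have orbM t y : orbit_below etaM t y -> exists a, y = emb M a.
  by move=> [i [l [_ ->]]]; exists (transform l (eta i)); apply: transform_etaM.
have alphaB y : B y -> fgen B (alpha y).
  move=> By; case: (By) => [[a Dy]|[[m [l [mm0 Dy]]]|/orbM[a Dy]]].
  - have -> : alpha y = y by rewrite Dy; exact: alphaM.
    exact: fgen_in.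
  - rewrite Dy alphav -Dy; apply: fgenD; first exact: fgen_in.
    by case: (_ == _); [apply: fgen1 | apply: fgen0].
  - have -> : alpha y = y by rewrite Dy; exact: alphaM.
    exact: fgen_in.
have walpha : alpha (transform k (ustar m0)) =
    transform k (ustar m0) - transform (k + s) (etaM j).
  rewrite !transform_ustar0 -embm1 rmorphN rmorph_sum -opprD; congr (- _).
  rewrite (bigD1 m1) //= [in RHS](bigD1 m1) //= rmorphM alphaM alphav eqxx mulrDl mul1r.
  rewrite addrAC; congr (_ + _ + _); apply: eq_bigr => m /andP[_ /negPf mm1].
  by rewrite rmorphM alphaM alphav xpair_eqE mm1 addr0.
(* [alpha] keeps [B] inside its generated field, so the image of [u_1^(k)] is algebraic as well, and
   the difference of the two is eta_j^(k+s). *)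
have aclB : acl B (transform (k + s) (etaM j)).
  have -> : transform (k + s) (etaM j) =
      transform k (ustar m0) - alpha (transform k (ustar m0)).
    by rewrite walpha opprB addrCA subrr addr0.
  apply: acl_closed; apply: fgenB; first exact: fgen_in.
  apply: fgen_in; apply: acl_trans (acl_image alpha wk) => _ [y By ->].
  exact/acl_fgen/alphaB.
apply: acl_drop_free => [y||].
- by case=> [[a ->]|/orbM[a ->]]; [exists (emb L a) | exists a].
- by rewrite -embm1; eexists.
- by apply: acl_mono aclB => y [|[|]]; rewrite /setjoin; tauto.
Qed.

(** * Counting ranks at the chosen zero *)

Context (d h t0 : nat) (d_gt0 : (0 < d)%N).
Context (rk : forall t, (t0 <= t)%N ->
  has_rank (base_set L) (orbit_below eta t.+1) (d * t.+1 + h)).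
Local Notation baseF := (base_set MF).

Lemma rank_etaM t : (t0 <= t)%N ->
  has_rank baseF (orbit_below etaM t.+1) (d * t.+1 + h).
Proof.
move=> /rk; apply: (generic_zero_rank (J := fun p => deval eta p = 0)) => p //.
by rewrite deval_etaM; split=> [/eqP|->]; rewrite ?rmorph0 // fmorph_eq0 => /eqP.
Qed.

(** Otherwise all transforms of [eta] would be algebraic over the [n * T] of order below [T], and
    the rank would be bounded although d > 0. *)
Lemma orbit_transcendental T :
  exists j, ~ acl (setjoin baseF (orbit_below etaM T)) (transform T (etaM j)).
Proof.
apply: contrapT => nex.
have dep j : acl (setjoin baseF (orbit_below etaM T)) (transform T (etaM j)).
  by apply: contrapT => nj; apply: nex; exists j.
have {}dep k : forall j, acl (setjoin baseF (orbit_below etaM T)) (transform k (etaM j)).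
  have [m] := ubnP k; elim: m k => // m IHm k ltkm j.
  have [kT|Tk] := ltnP k T; first by apply: acl_in; right; exists j, k.
  have := acl_transform_orbit (k - T) (dep j); rewrite transform_add subnK //.
  apply: acl_trans => y [yb|[i [l [lk ->]]]]; first by apply: acl_in; left.
  by apply: IHm; apply: leq_trans lk _; rewrite -ltnS.
(* At this order the rank is at least n T + 1. *)
have rkT := rank_etaM (leq_maxl t0 (n * T)).
have := has_rank_geq (t := map (orbit_fam etaM) (orbit_index 'I_n T)) rkT.
rewrite size_map size_orbit_index card_ord leqNgt => /(_ _)/negP; apply.
  move=> _ [j [k [_ ->]]]; apply: acl_mono (dep k j) => y [|]; first by left.
  by move/orbit_belowP; right.
apply: leq_trans (leq_addr _ _); rewrite -[X in (X < _)%N]mul1n.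
apply: (@leq_trans (1 * (maxn t0 (n * T)).+1)); first by rewrite !mul1n ltnS leq_maxr.
by rewrite leq_mul2r d_gt0 orbT.
Qed.

Lemma ustar0_transcendental k :
  ~ acl (setjoin baseF (setjoin free_coefs (orbit_below etaM (k + s))))
      (transform k (ustar m0)).
Proof.
have [j nj] := orbit_transcendental (k + s).
exact: transform_ustar0_transcendental nj.
Qed.

Lemma ustar0_acl k T : (k + s < T)%N ->
  acl (setjoin baseF (setjoin free_coefs (orbit_below etaM T))) (transform k (ustar m0)).
Proof.
move=> ksT; apply: acl_closed; rewrite transform_ustar0 -sub0r.
apply: fgenB; first exact: fgen0.
elim/big_ind: _ => [|x y|m mm0]; [exact: fgen0 | exact: fgenD |].
apply: fgenM; apply: fgen_in; first by apply: acl_in; right; left; exists m, k.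
have : acl (setjoin baseF (orbit_below etaM s.+1)) (deval etaM (dmonom_poly F m)).
  apply: acl_fgen.
  have -> : deval etaM (dmonom_poly F m) =
      \prod_w transform (val w.2) (etaM w.1) ^+ val m w.
    rewrite /dmonom_poly rmorph_prod; apply: eq_bigr => w _.
    apply: etrans (rmorphXn _ _ _) _; apply: (congr1 (fun x => x ^+ _)).
    exact: devalX.
  elim/big_ind: _ => [|x y|w _]; [exact: fgen1 | exact: fgenM |].
  elim: (val m w : nat) => [|e IHe]; first exact: fgen1.
  rewrite exprS; apply: fgenM => //; apply: fgen_in; right.
  by exists w.1, (val w.2); split=> //; apply: (ltn_ord w.2).
have -> : emb M (transform k (mval m)) = transform k (deval etaM (dmonom_poly F m)).
  by rewrite deval_etaM; exact: emb_transform.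
move/(acl_transform_orbit k); apply: acl_mono => y [|]; first by left.
by move=> yo; right; right; apply: orbit_belowS yo; rewrite addnS.
Qed.

(** Highest order first, since [indep] tests an entry against those after it. *)
Definition ustar0_seq (t q : nat) : seq MF :=
  [seq transform k (ustar m0) | k <- rev (iota t q)].

Lemma ustar0_seqS t q :
  ustar0_seq t q.+1 = transform (t + q) (ustar m0) :: ustar0_seq t q.
Proof. by rewrite /ustar0_seq -addn1 iotaD rev_cat. Qed.

Lemma mem_ustar0_seq t q y : y \in ustar0_seq t q ->
  exists2 k, (t <= k < t + q)%N & y = transform k (ustar m0).
Proof. by case/mapP=> k; rewrite mem_rev mem_iota => kt ->; exists k. Qed.

(** The earlier u_1^(k) are algebraic over the free coefficients and the transforms of [eta] of
    order below t + q + s, over which u_1^(t+q) is still transcendental. *)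
Lemma ustar0_seq_indep t q :
  indep (setjoin baseF (setjoin free_coefs (orbit_below etaM (t + s)))) (ustar0_seq t q).
Proof.
elim: q => // q IHq; rewrite ustar0_seqS; split=> // wq.
apply: (@ustar0_transcendental (t + q)).
apply: acl_trans wq => y [[yb|[yV|yo]]|/mem_ustar0_seq[k /andP[_ kq] ->]].
- by apply: acl_in; left.
- by apply: acl_in; right; left.
- apply: acl_in; right; right; apply: orbit_belowS yo.
  by rewrite leq_add2r leq_addr.
- by apply: ustar0_acl; rewrite ltn_add2r.
Qed.

Lemma ustar_indep : transf_indep ustar.
Proof.
apply/alg_indepP => l ul.
pose N := (\max_(w <- l) w.2.+1)%N.
pose lo := [seq w <- orbit_index (dmonom n s r) N | w.1 != m0].
pose hi : seq (dmonom n s r * nat) := [seq (m0, k) | k <- rev (iota 0 N)].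
have lo_uniq : uniq lo by rewrite filter_uniq ?orbit_index_uniq.
have hi_uniq : uniq hi by rewrite map_inj_uniq ?rev_uniq ?iota_uniq // => ? ? [].
have loE : map (orbit_fam ustar) lo = map (orbit_fam v) lo.
  by apply/eq_in_map => w; rewrite mem_filter => /andP[w0 _]; apply: transform_ustar.
apply: (indep_perm (t := hi ++ lo)) => //.
- rewrite cat_uniq lo_uniq hi_uniq andbT; apply/hasPn => w; rewrite mem_filter => /andP[w0 _].
  by apply: contra w0 => /mapP[k _ ->].
- move=> w wl; have wN : (w.2 < N)%N by exact: (leq_bigmax_seq (F := fun w => w.2.+1) _ wl).
  rewrite mem_cat mem_filter mem_orbit_index wN andbT orbC.
  have [w0|//] := eqVneq w.1 m0; apply/mapP; exists w.2; first by rewrite mem_rev mem_iota.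
  by rewrite -w0; case: (w).
rewrite map_cat; apply/indep_cat; split.
  apply: (indep_mono (C := rmorph_range (emb M))).
    by move=> _ [a ->]; apply: acl_in; exists (emb L a).
  by rewrite loE; move/alg_indepP: v_indep; apply.
have -> : map (orbit_fam ustar) hi = ustar0_seq 0 N by rewrite /hi -map_comp.
apply: indep_mono (ustar0_seq_indep 0 N) => y [yb|/mapP[w]].
  by apply: acl_in; left.
rewrite mem_filter => /andP[w0 _] ->; apply: acl_in; right; left.
by exists w.1, w.2; split=> //; apply: transform_ustar.
Qed.

Lemma indep_free_coefs T (l : seq MF) : (forall x, x \in l -> orbit_below etaM T x) ->
  indep baseF l -> indep (setjoin baseF free_coefs) l.
Proof.
have orbM y : orbit_below etaM T y -> rmorph_range (emb M) y.
  by move=> [i [k [_ ->]]]; exists (transform k (eta i)); apply: transform_etaM.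
elim: l => //= x l IHl lT [Bl nx]; split.
  by apply: IHl => // y yl; apply: lT; rewrite inE yl orbT.
move=> Vx; apply: nx; apply: acl_drop_free => [y [[a ->]|yl]||].
- by exists (emb L a).
- by apply/orbM/lT; rewrite inE [y \in l]yl orbT.
- by apply/orbM/lT/mem_head.
- by apply: acl_mono Vx => y [[]|]; rewrite /setjoin; tauto.
Qed.

Definition drop_base (q : nat) : MF -> Prop :=
  setjoin baseF (setjoin free_coefs (inseq (ustar0_seq 0 q))).

(** A basis over [drop_base], followed by the q = t + 1 - s adjoined u_1^(k), is a basis over [F]
    and the free coefficients, where the rank is still d(t+1) + h. *)
Lemma rank_over_free_coefs t : (maxn t0 s <= t)%N ->
  has_rank (drop_base (t.+1 - s)) (orbit_below etaM t.+1) (d.-1 * t.+1 + (h + s)).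
Proof.
rewrite geq_max => /andP[/rank_etaM rT st].
set T := t.+1 in rT *; set q := (T - s)%N; pose B0 := setjoin baseF free_coefs.
have rB0 : has_rank B0 (orbit_below etaM T) (d * T + h).
  have [l [lT lo lI lsp]] := rT; exists l; split=> //; first exact: (indep_free_coefs lo lI).
  by move=> x /lsp; apply: acl_mono => y [yb|yl]; [left; left | right].
have [ks [ksT ksI ksp]] := rank_seq (drop_base q) (orbit_fam etaM) (orbit_index 'I_n T).
set l := map _ ks in ksI ksp.
have lo x : x \in l -> orbit_below etaM T x.
  by case/mapP=> w /(mem_subseq ksT) wT ->; apply/orbit_belowP; apply: map_f.
have lsp x : orbit_below etaM T x -> acl (setjoin (drop_base q) (inseq l)) x.
  by move/orbit_belowP/mapP=> [w /ksp wl ->].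
have lWI : indep B0 (l ++ ustar0_seq 0 q).
  apply/indep_cat; split.
    apply: indep_mono (ustar0_seq_indep 0 q) => y yB; apply: acl_in.
    by case: yB => [yb|yV]; [left | right; left].
  apply: indep_mono ksI => y yB; apply: acl_in.
  by case: yB => [[yb|yV]|yW]; [left | right; left | right; right].
have sT : (s <= T)%N by apply: leq_trans st _.
have up : (size l + q <= d * T + h)%N.
  have := has_rank_leq rB0 lWI; rewrite size_cat !size_map size_rev size_iota; apply.
  move=> y; rewrite mem_cat => /orP[/lo yo|/mem_ustar0_seq[k /andP[_ kq] ->]].
    by apply: acl_in; right.
  apply: acl_mono (ustar0_acl (k := k) (T := T) _); last by rewrite addnC -ltn_subRL.
  by move=> z [zb|[zV|zo]]; [left; left | left; right | right].
have lo' : (d * T + h <= size l + q)%N.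
  have := has_rank_geq (t := l ++ ustar0_seq 0 q) rB0.
  rewrite size_cat !size_map size_rev size_iota; apply=> x /lsp; apply: acl_mono => y.
  case=> [[yb|[yV|yW]]|yl]; [by left; left | by left; right | |].
    by right; rewrite /inseq mem_cat [y \in ustar0_seq _ _]yW orbT.
  by right; rewrite /inseq mem_cat [y \in l]yl.
(* Removing T - s from d T + h leaves (d - 1) T + (h + s): this is the origin of the new order. *)
have sl : size l = (d.-1 * T + (h + s))%N.
  have DdT : (d * T + h)%N = (d.-1 * T + (h + s) + q)%N.
    rewrite -{1}(prednK d_gt0) mulSn -{1}(subnK sT) -/q.
    by rewrite (ACl (3 * (4 * 2) * 1)%AC).
  by apply/eqP; rewrite -(eqn_add2r q) -DdT eqn_leq up.
by exists l; split.
Qed.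

(** * The coefficient field F<u> inside the free extension *)

Context (K : diffExt F) (u : dmonom n s r -> K) (u_indep : transf_indep u).
Context (K_gen : forall z : K, gen_diff_field (fun x => exists m, x = u m) z).

Definition coef_orbit : K -> Prop := fun y => exists i, y = orbit_fam u i.

Lemma coef_field_fgen z : fgen (setjoin (base_set K) coef_orbit) z.
Proof.
apply: (K_gen z); last by move=> _ [m ->]; apply: fgen_in; right; exists (m, 0%N).
split; first split=> [a|x y|x y|x]; [|exact: fgenB|exact: fgenM|exact: fgenV|].
  by apply: fgen_in; left; exists a.
move=> x /(fgen_image (shift K)); apply: fgen_sub => _ [y [[a ->]|[[m k] ->]] ->].
  by apply: fgen_in; left; exists (shift F a); rewrite emb_shift.
by apply: fgen_in; right; exists (m, k.+1).
Qed.

Lemma coef_field_fraction z : exists p q, peval (emb K) (orbit_fam u) q != 0 /\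
  z = peval (emb K) (orbit_fam u) p / peval (emb K) (orbit_fam u) q.
Proof.
have [x [y [Bx By y0 ->]]] := fgen_fraction (coef_field_fgen z).
have sub w : setjoin (base_set K) coef_orbit w ->
    rmorph_range (emb K) w \/ exists2 i, True & w = orbit_fam u i.
  by case=> [|[i ->]]; [left | right; exists i].
have [p _ Dx] := rgen_over sub Bx; have [q _ Dy] := rgen_over sub By.
by exists p, q; rewrite -Dx -Dy.
Qed.

Lemma coef_field_embedding : exists theta : {rmorphism K -> MF},
  [/\ forall a, theta (emb K a) = emb MF a, forall m, theta (u m) = ustar m &
      forall z, theta (shift K z) = shift MF (theta z)].
Proof.
have [theta thetaE] : exists theta : {rmorphism K -> MF}, forall p,
    theta (peval (emb K) (orbit_fam u) p) = peval (emb MF) (orbit_fam ustar) p.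
  apply: fraction_rmorphism coef_field_fraction => p.
  by split=> [/u_indep->|/ustar_indep->]; apply: raddf0.
have thetaF a : theta (emb K a) = emb MF a.
  by have := thetaE (malgC a); rewrite !pevalC.
have thetau m k : theta (transform k (u m)) = transform k (ustar m).
  by have := thetaE (pvar F (m, k)); rewrite !pevalX.
exists theta; split=> // [m|z]; first exact: (thetau m 0%N).
(* Commutation with every transform defines a set closed under the shift; commutation with the shift
   alone would not provide that closure. *)
suff : forall k, theta (transform k z) = transform k (theta z) by move/(_ 1%N).
apply: (K_gen z (S := fun z => forall k, theta (transform k z) = transform k (theta z))).
  split; first split=> [a|x y xP yP|x y xP yP|x xP] k.
  - by rewrite -emb_transform !thetaF emb_transform.
  - by rewrite !rmorphB xP yP.
  - by rewrite !rmorphM xP yP.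
  - by rewrite !fmorphV xP.
  move=> x xP k; have := xP k.+1; rewrite /transform !iterSr => ->.
  by have := xP 1%N; rewrite /transform /= => ->.
by move=> _ [m ->] k; rewrite thetau (thetau m 0%N).
Qed.

Context (theta : {rmorphism K -> MF}).
Context (thetaF : forall a, theta (emb K a) = emb MF a).
Context (theta_u : forall m, theta (u m) = ustar m).
Context (theta_shift : forall z, theta (shift K z) = shift MF (theta z)).

Definition coef_ext : diffExt K := @DiffExt K MF theta theta_shift.
Local Notation MK := coef_ext.

Lemma theta_transform k z : theta (transform k z) = transform k (theta z).
Proof. exact: (@emb_transform K MK k z). Qed.

Definition ustar0_orbit : MF -> Prop := fun y => exists k, y = transform k (ustar m0).

Lemma coef_field_acl y :
  base_set MK y -> acl (setjoin baseF (setjoin free_coefs ustar0_orbit)) y.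
Proof.
move=> [z ->]; apply: acl_fgen.
apply: fgen_sub (fgen_image theta (coef_field_fgen z)) => _ [x [[a ->]|[[m k] ->]] ->].
  by apply: fgen_in; left; exists a; rewrite thetaF.
rewrite /orbit_fam theta_transform theta_u /=; apply: fgen_in; right.
have [->|mm0] := eqVneq m m0; first by right; exists k.
by left; exists m, k; split=> //; apply: transform_ustar.
Qed.

Lemma coef_field_drop_base q y : drop_base q y -> base_set MK y.
Proof.
case=> [[a ->]|[[m [k [mm0 ->]]]|/mem_ustar0_seq[k _ ->]]].
- by exists (emb K a); apply: esym (thetaF a).
- exists (transform k (u m)); rewrite -(transform_ustar k mm0) -theta_u.
  exact: esym (theta_transform _ _).
- exists (transform k (u m0)); rewrite -theta_u.
  exact: esym (theta_transform _ _).
Qed.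

(** Passes from finitely many u_1^(k) to all of F<u>: those with k >= t - s are free over the field
    containing everything of order below [t], so they create no relation there. *)
Lemma drop_base_indep t (l : seq MF) : (s <= t)%N ->
  (forall x, x \in l -> orbit_below etaM t x) ->
  indep (drop_base (t - s)) l -> indep (base_set MK) l.
Proof.
move=> st lt Dl; apply: indep_mono coef_field_acl _.
set q := (t - s)%N in Dl; have qst : (q + s)%N = t by rewrite subnK.
elim: l lt Dl => //= x l IHl lt [Dl nx]; split.
  by apply: IHl Dl => y yl; apply: lt; rewrite inE yl orbT.
have lo y : y \in l -> orbit_below etaM t y.
  by move=> yl; apply: lt; rewrite inE yl orbT.
pose Z y := exists2 k, (q <= k)%N & y = transform k (ustar m0).
move=> Bx; apply: nx; apply: (acl_disjoint (Z := Z)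
  (C := setjoin baseF (setjoin free_coefs (orbit_below etaM (q + s))))).
- rewrite qst => y [[yb|[yV|/mem_ustar0_seq[k /andP[_ kq] ->]]]|/lo yo].
  + by apply: acl_in; left.
  + by apply: acl_in; right; left.
  + by apply: ustar0_acl; rewrite -qst ltn_add2r.
  + by apply: acl_in; right; right.
- by rewrite qst; apply: acl_in; right; right; apply: lt; apply: mem_head.
- move=> l' l'Z; suff [N l'N] : exists N, {subset l' <= ustar0_seq q N}.
    by exists (ustar0_seq q N) => //; apply: ustar0_seq_indep.
  elim: l' l'Z => [|y l' IHl'] yl'Z; first by exists 0%N.
  have [|N l'N] := IHl'; first by move=> z zl; apply: yl'Z; rewrite inE zl orbT.
  have [k qk Dy] := yl'Z y (mem_head _ _); exists (maxn N (k - q).+1) => z.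
  rewrite inE => /orP[/eqP->|/l'N/mem_ustar0_seq[i /andP[qi iN] ->]].
    rewrite Dy; apply: map_f; rewrite mem_rev mem_iota qk /=.
    by rewrite -{1}(subnKC qk) ltn_add2l leq_maxr.
  apply: map_f; rewrite mem_rev mem_iota qi /=.
  by apply: leq_trans iN _; rewrite leq_add2l leq_maxl.
- apply: acl_mono Bx => y [[yb|[yV|[k Dk]]]|yl]; [by left; left; left | | |].
  + by left; left; right; left.
  + have [kq|qk] := ltnP k q; last by right; exists k.
    left; left; right; right; rewrite Dk; apply: map_f.
    by rewrite mem_rev mem_iota.
  + by left; right.
Qed.

Lemma rank_coef_ext t : (maxn t0 s <= t)%N ->
  has_rank (base_set MK) (orbit_below (etaM : 'I_n -> MK) t.+1) (d.-1 * t.+1 + (h + s)).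
Proof.
move=> tt; have [l [ls lo lI lsp]] := rank_over_free_coefs tt.
have st : (s <= t.+1)%N.
  by apply: leq_trans (leqnSn _); apply: leq_trans tt; apply: leq_maxr.
exists l; split=> //; first exact: drop_base_indep lI.
move=> x /lsp; apply: acl_mono => y [/coef_field_drop_base|]; first by left.
by right.
Qed.

(** * The generated ideal is the vanishing ideal *)

Context (I : {dpoly F[n]} -> Prop) (eta_generic : is_generic_zero I eta).
Local Notation etaK := (etaM : 'I_n -> MK).
Local Notation J := (gen_diff_ideal (fun q : {dpoly K[n]} =>
  (exists2 p, I p & q = dmap K p) \/ q = generic_poly u)).

Lemma deval_dmap p : deval etaK (dmap K p) = emb M (deval eta p).
Proof.
rewrite -deval_etaM; apply: (malg_rmorph_eq (f := deval etaK \o @dmap F n K)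
  (g := deval (L := MF) etaM)) p => [c|w].
  apply: etrans (congr1 _ (dmapC n K c)) _; apply: etrans (devalC etaK _) _.
  by exact: etrans (thetaF c) (esym (devalC (etaM : 'I_n -> MF) c)).
apply: etrans (congr1 _ (dmapX K w)) _; apply: etrans (devalX etaK _) _.
exact: esym (devalX (etaM : 'I_n -> MF) w).
Qed.

Lemma deval_generic_poly : deval etaK (generic_poly u) = 0.
Proof.
have term m : deval etaK (malgC (u m) * dmonom_poly K m) = ustar m * emb M (mval m).
  apply: etrans (rmorphM (deval etaK) _ _) _; apply: congr2.
    by apply: etrans (devalC etaK _) _; apply: theta_u.
  by rewrite -dmap_dmonom_poly; exact: deval_dmap.
rewrite generic_polyE; apply: etrans (rmorph_sum (deval etaK) _ _ _) _.
apply: etrans (eq_bigr _ (fun m _ => term m)) _; rewrite (bigD1 m0) //=.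
rewrite /mval dmonom_poly0; have -> : deval eta 1 = 1 by exact: rmorph1.
rewrite rmorph1 mulr1 {1}/ustar eqxx addrC; apply/eqP; rewrite subr_eq0; apply/eqP.
by apply: eq_bigr => m /negPf mm0; rewrite /ustar mm0.
Qed.

Lemma ideal_vanishes p : J p -> deval etaK p = 0.
Proof.
move=> /(_ (fun p => deval etaK p = 0)).
apply; first by have [] := vanishing_ideal etaK.
move=> _ [[q Iq ->]|->]; last exact: deval_generic_poly.
by rewrite deval_dmap; have /eta_generic-> := Iq; rewrite rmorph0.
Qed.

Local Notation rho := (peval (@dmap F n K)
  (fun w : dmonom n s r * nat => malgC (orbit_fam u w))).

(** Coefficients in F<u> are fractions in the u^(k); a common denominator moves the polynomial into
    the image of F{y}[u^(k)], the ring where the elimination takes place. *)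
Lemma dpoly_denominator (p : {dpoly K[n]}) :
  exists (c : K) q, c != 0 /\ rho q = malgC c * p.
Proof.
(* F[u^(k)] as the part of F{y}[u^(k)] constant in the y's; it supplies the cross factors when
   fractions are added. *)
pose toR := peval (malgC \o malgC : F -> {malg {dpoly F[n]}[{cmonom (dmonom n s r * nat)%type}]})
  (fun w : dmonom n s r * nat => pvar {dpoly F[n]} w).
have rho_const (a : {malg F[{cmonom (dmonom n s r * nat)%type}]}) :
    rho (toR a) = malgC (peval (emb K) (orbit_fam u) a).
  apply: (malg_rmorph_eq (f := rho \o toR)
    (g := (malgC : K -> {dpoly K[n]}) \o peval (emb K) (orbit_fam u))) a => [c|w].
    apply: etrans (congr1 rho (pevalC _ _ _)) _; apply: etrans (pevalC _ _ _) _.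
    apply: etrans (dmapC n K c) _; apply: (congr1 malgC).
    exact: esym (pevalC _ _ _).
  apply: etrans (congr1 rho (pevalX _ _ _)) _; apply: etrans (pevalX _ _ _) _.
  by apply: (congr1 malgC); exact: esym (pevalX _ _ _).
pose ev := peval (emb K) (orbit_fam u).
suff [b [q [b0 e]]] : exists b q, ev b != 0 /\ rho q = malgC (ev b) * p.
  by exists (ev b), q.
elim/malg_ind: p => [z|w|p1 p2 [b1 [q1 [b10 e1]]] [b2 [q2 [b20 e2]]]
  |p1 p2 [b1 [q1 [b10 e1]]] [b2 [q2 [b20 e2]]]].
- have [a [b [b0 ->]]] := coef_field_fraction z.
  exists b, (toR a); split=> //.
  apply: etrans (rho_const a) _; apply: etrans (mpolyCM _ _ _).
  by rewrite /ev mulrC divfK.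
- exists 1, (malgC (pvar F w)); rewrite /ev rmorph1; split; first exact: oner_neq0.
  apply: etrans (pevalC _ _ _) _; apply: etrans (dmapX K w) _.
  exact: esym (mul1r _).
- have ev12 : ev (b1 * b2) = ev b1 * ev b2 by exact: pevalM.
  exists (b1 * b2), (toR b2 * q1 + toR b1 * q2); rewrite ev12.
  split; first exact: mulf_neq0.
  apply: etrans (pevalD _ _ _ _) _; apply: etrans (congr2 +%R (pevalM _ _ _ _) (pevalM _ _ _ _)) _.
  apply: etrans (congr2 +%R (congr2 *%R (rho_const b2) e1) (congr2 *%R (rho_const b1) e2)) _.
  apply: etrans (congr1 (fun x => x * _) (esym (mpolyCM _ _ _))).
  apply: etrans (esym (mulrDr _ _ _)); apply: (congr2 +%R).
    by apply: etrans (mulrA _ _ _) _; apply: (congr1 (fun x => x * _)); exact: mulrC.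
  exact: mulrA.
- have ev12 : ev (b1 * b2) = ev b1 * ev b2 by exact: pevalM.
  exists (b1 * b2), (q1 * q2); rewrite ev12; split; first exact: mulf_neq0.
  apply: etrans (pevalM _ _ _ _) _; apply: etrans (congr2 *%R e1 e2) _.
  apply: etrans (mulrACA _ _ _ _) _; apply: (congr1 (fun x => x * _)).
  exact: esym (mpolyCM _ _ _).
Qed.

Lemma ideal_generator q :
  (exists2 p, I p & q = dmap K p) \/ q = generic_poly u -> J q.
Proof. by move=> Xq J' _; apply. Qed.

Lemma ideal_transform_generic k : J (iter k (@ptransform K n) (generic_poly u)).
Proof.
apply: (iter_ptransform_ideal (J := J)); first exact: gen_diff_ideal_is_ideal.
by apply: ideal_generator; right.
Qed.

Lemma iter_ptransform_generic k : iter k (@ptransform K n) (generic_poly u) =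
  \sum_m dmap K (iter k (@ptransform F n) (dmonom_poly F m)) *
          malgC (transform k (u m)).
Proof.
rewrite generic_polyE; apply: etrans (rmorph_sum (iter k (@ptransform K n)) _ _ _) _.
apply: eq_bigr => m _; apply: etrans (rmorphM (iter k (@ptransform K n)) _ _) _.
apply: etrans (mulrC _ _) _; apply: congr2; last exact: iter_ptransformC.
by rewrite dmap_iter_ptransform dmap_dmonom_poly.
Qed.

Definition eliminant (k : nat) :
    {malg {dpoly F[n]}[{cmonom (dmonom n s r * nat)%type}]} :=
  \sum_(m | m != m0)
    malgC (iter k (@ptransform F n) (dmonom_poly F m)) * pvar {dpoly F[n]} (m, k).

Definition eliminate (i : dmonom n s r * nat) :
    {malg {dpoly F[n]}[{cmonom (dmonom n s r * nat)%type}]} :=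
  if i.1 == m0 then - eliminant i.2 else pvar {dpoly F[n]} i.

Lemma eliminate_over i : over (fun i => i.1 != m0) (eliminate i).
Proof.
rewrite /eliminate; case: ifP => [_|/negbT i0]; last exact: overX.
by apply: overN; apply: over_sum => m m00; apply: overM; [apply: overC | apply: overX].
Qed.

(** For i = (m0, k) the difference is exactly the k-th transform of the generic polynomial, whose
    constant monomial has coefficient u_1^(k). *)
Lemma eliminate_ideal i : J (malgC (orbit_fam u i) - rho (eliminate i)).
Proof.
case: i => m1 k; rewrite /eliminate; case: eqP => [/= ->|_]; last first.
  rewrite pevalX subrr; by have [] := gen_diff_ideal_is_ideal (fun q : {dpoly K[n]} =>
    (exists2 p, I p & q = dmap K p) \/ q = generic_poly u).
have := ideal_transform_generic k; congr J.
rewrite iter_ptransform_generic (bigD1 m0) //; apply: congr2.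
  have e1 : dmap K (iter k (@ptransform F n) (dmonom_poly F m0)) = 1.
    rewrite dmap_iter_ptransform dmap_dmonom_poly dmonom_poly0; exact: rmorph1.
  by rewrite e1; apply: mul1r.
have e2 : rho (eliminant k) = \sum_(m | m != m0)
    dmap K (iter k (@ptransform F n) (dmonom_poly F m)) * malgC (transform k (u m)).
  apply: etrans (rmorph_sum _ _ _ _) _; apply: eq_bigr => m _.
  by apply: etrans (pevalM _ _ _ _) _; apply: congr2; [exact: pevalC | exact: pevalX].
exact: esym (etrans (congr1 -%R (pevalN _ _ _)) (etrans (opprK _) e2)).
Qed.

Lemma vanishing_in_ideal p : deval etaK p = 0 -> J p.
Proof.
move=> p0; have [J0 JD JM Jt] := gen_diff_ideal_is_ideal (fun q : {dpoly K[n]} =>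
  (exists2 p, I p & q = dmap K p) \/ q = generic_poly u).
have [c [q [c0 e]]] := dpoly_denominator p.
have rho0 : deval etaK (rho q) = 0.
  apply: etrans (congr1 _ e) _; apply: etrans (rmorphM (deval etaK) _ _) _.
  exact: etrans (congr1 (fun x => _ * x) p0) (mulr0 _).
have Jq : J (rho q).
  pose e' : {rmorphism {dpoly F[n]} -> M} := emb M \o deval eta.
  pose ev : {rmorphism {dpoly K[n]} -> M} := deval etaK.
  pose delta : {rmorphism {dpoly F[n]} -> {dpoly K[n]}} := @dmap F n K.
  pose coef (w : dmonom n s r * nat) : {dpoly K[n]} := malgC (orbit_fam u w).
  apply: (elimination_ideal (ev := ev) (delta := delta) (J := J) (e := e')
    (c := coef) (w := orbit_fam v) J0 JD JM ideal_vanishes eliminate_over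
    eliminate_ideal deval_dmap) rho0.
  - move=> i i0; apply: etrans (devalC etaK _) _; apply: etrans (theta_transform _ _) _.
    by rewrite theta_u; apply: transform_ustar.
  - move=> a /eqP; rewrite fmorph_eq0 => /eqP/eta_generic Ia.
    by apply: ideal_generator; left; exists a.
  - move=> q' /(peval_coef0 v_indep) q'0 m.
    exact: etrans (congr1 (emb M) (q'0 m)) (rmorph0 _).
(* The denominator is a nonzero constant of [K], hence invertible in the polynomial ring. *)
have -> : p = malgC c^-1 * rho q; last exact: JM.
apply: etrans (esym (mul1r p)) _; apply: etrans (congr1 (fun x => _ * x) (esym e)).
apply: etrans (esym (mulrA _ _ _)); apply: (congr1 (fun x => x * p)).
by apply: etrans (mpolyCM _ _ _); rewrite mulVf.
Qed.

Lemma generic_section : [/\ is_reflexive_prime_diff_ideal J,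
  has_dim J d.-1 & has_ord J (h + s)].
Proof.
have JE p : deval etaK p = 0 <-> J p.
  by split; [apply: vanishing_in_ideal | apply: ideal_vanishes].
have dimJ : has_dim J d.-1.
  exists MK, etaK; split=> //.
  exact: (rank_transf_trdeg (c := h + s) (t0 := maxn t0 s)) rank_coef_ext.
split=> //; first exact: is_reflexive_prime_diff_ideal_eq JE (vanishing_ideal _).
exists d.-1; split=> //; exists MK, etaK; split=> //; exists (maxn t0 s) => t tt.
exact/trunc_field_rank/rank_coef_ext.
Qed.

End GenericExtension.

Theorem theorem5p5 (F : diffField) (n : nat) (I : {dpoly F[n]} -> Prop)
    (d h : nat) (I_rp : is_reflexive_prime_diff_ideal I)
    (d_gt0 : (0 < d)%N) (I_dim : has_dim I d) (I_ord : has_ord I h)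
    (s r : nat) (r_gt0 : (0 < r)%N)
    (K : diffExt F) (u : dmonom n s r -> K)
    (u_indep : transf_indep u)
    (K_gen : forall z : K, gen_diff_field (fun x => exists m, x = u m) z) :
  let J := gen_diff_ideal (fun q : {dpoly K[n]} =>
             (exists2 p, I p & q = dmap K p) \/ q = generic_poly u) in
  [/\ is_reflexive_prime_diff_ideal J, has_dim J (d - 1)%N &
      has_ord J (h + s)%N].
Proof.
have [L [eta [eta_generic [t0 rk]]]] := dim_ord_rank I_dim I_ord.
(* The coefficients are free over all of [L], not only over [F]; this separates them from every
   transform of [eta]. *)
have [M [v [v_indep fracM]]] := free_diff_ext L (dmonom n s r).
have [theta [thetaF theta_u theta_shift]] :=
  coef_field_embedding r_gt0 v_indep fracM d_gt0 rk u_indep K_gen.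
rewrite subn1; exact: (generic_section r_gt0 v_indep fracM d_gt0 rk K_gen thetaF
  theta_u theta_shift eta_generic).
Qed.
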